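(* Let $f:\mathbb{N}\to\mathbb{R}$ be an increasing function. Let $1\to H\to G\to K\to 1$ be a short exact sequence of groups, where $H$ is abelian. Let $\mu$ be a non-degenerate finite entropy probability measure on $G$ whose projection $\mu_K$ to $K$ is $f$-cautious and Liouville. Fix a finite generating set $S\subset K$ and a finite set $T\subset H$. Consider the following condition on $T$: $( * )$ for every $\varepsilon>0$ there exist $\delta>0$ and $C_\varepsilon>0$ such that $\mathrm{Span}_{S,T}(\delta f(n),n)\le C_\varepsilon(1+\varepsilon)^n$ for all $n$. 1. If $T$ satisfies $( * )$ and $T$ generates $H$, then the random walk $(G,\mu)$ is also Liouville. 2. More generally, let $h\in H$. If the set $T_h=\{h\}$ satisfies $( * )$, then $h$ acts trivially on the Poisson boundary of $(G,\mu)$.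
   Context: A measure is non-degenerate if its support generates the group as a semigroup; entropy is $-\sum_g\mu(g)\log\mu(g)$. A random walk is Liouville if its Poisson boundary is trivial. $G$ acts on the Poisson boundary through left translation of trajectories. $f$-cautiousness: let $X_m$ be the random walk $(K,\mu_K)$ and $|\cdot|$ the word length on $K$ with respect to a finite generating set. It is $f$-cautious (along some subsequence) if for every $\varepsilon>0$ $$\limsup_{n}\mathbb{P}\Big[\max_{1\le m\le n}|X_m|/f(n)<\varepsilon\Big]>0.$$ Span function: since $H$ is abelian, $K$ acts on $H$ by conjugation in $G$. Let $T_r$ be the set of all elements of $H$ of the form $g(t)$ with $t\in T$ and $g\in K$ of word length at most $r$ with respect to $S$. Let $T_{r,n}$ be the set of all elements that are a product of at most $n$ elements of $T_r$. Then $\mathrm{Span}_{S,T}(r,n)$ is the cardinality of $T_{r,n}$.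
   Formalization: The function f is additionally assumed to take at least one positive value (hence to be eventually positive); for f negative everywhere, f-cautiousness and ( * ) hold automatically and the claim fails. *)

(* Defs.v *)
From HB Require Import structures.
From mathcomp Require Import all_boot all_order all_algebra.
From mathcomp Require Import all_classical all_reals all_analysis.

Set Implicit Arguments.
Unset Strict Implicit.
Unset Printing Implicit Defensive.
Import Order.TTheory GRing.Theory Num.Theory.
Import numFieldNormedType.Exports.

Local Open Scope classical_set_scope.
Local Open Scope ring_scope.

(* Groups are abstract, possibly infinite, multiplicative [groupType]s, viewed
   as discrete spaces; a probability measure on a group is given by its mass
   function. *)

Definition is_prob (R : realType) (G : groupType) (mu : G -> R) : Prop :=
  (forall g, 0 <= mu g) /\ \esum_(g in [set: G]) (mu g)%:E = 1%E.

(* [ln 0 = 0], so points of mass 0 do not contribute; all terms are >= 0. *)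
Definition entropy (R : realType) (G : groupType) (mu : G -> R) : \bar R :=
  \esum_(g in [set: G]) (- (mu g * ln (mu g)))%:E.

Definition non_degenerate (R : realType) (G : groupType) (mu : G -> R) : Prop :=
  forall g : G, exists s : seq G,
    [/\ s != [::], (forall x, x \in s -> mu x != 0)
      & g = (\prod_(x <- s) x)%g].

Definition projection (R : realType) (G K : groupType) (p : G -> K)
    (mu : G -> R) : K -> R :=
  fun k => fine (\esum_(g in p @^-1` [set k]) (mu g)%:E).

Definition subgroup (G : groupType) (A : set G) : Prop :=
  [/\ A 1%g, (forall x y, A x -> A y -> A (x * y)%g)
    & (forall x, A x -> A (x^-1)%g)].

Definition generates (G : groupType) (S : set G) : Prop :=
  forall A : set G, subgroup A -> S `<=` A -> A = [set: G].

Definition is_word (G : groupType) (S : set G) (n : nat) (g : G) : Prop :=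
  exists s : seq G,
    [/\ size s = n, (forall x, x \in s -> S x \/ S (x^-1)%g)
      & g = (\prod_(x <- s) x)%g].

(* The word length; the set below is a singleton when [S] generates. *)
Definition wlen (G : groupType) (S : set G) (g : G) : nat :=
  get [set n | is_word S n g /\ forall m, is_word S m g -> (n <= m)%N].

Definition short_exact (H G K : groupType) (i : {multiplicative H -> G})
    (p : {multiplicative G -> K}) : Prop :=
  [/\ injective i, range i = p @^-1` [set 1%g] & range p = [set: K]].

(** * Trajectories *)

Definition traj (G : groupType) : Type := nat -> G.

HB.instance Definition _ (G : groupType) := Choice.copy (traj G) (nat -> G).
HB.instance Definition _ (G : groupType) :=
  isPointed.Build (traj G) (fun=> 1%g : G).

Definition cylinders (G : groupType) : set (set (traj G)) :=
  [set C | exists (n : nat) (B : set G), C = [set x | B (x n)]].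

(* The path space: G^nat with the product of the discrete sigma-algebras. *)
Definition path_space (G : groupType) := g_sigma_algebraType (@cylinders G).

(* [P] is the law of the trajectories X_0 = 1, X_n = g_1 * ... * g_n of the
   random walk (G, mu), with g_1, g_2, ... independent of law [mu]. *)
Definition walk_law (R : realType) (G : groupType) (mu : G -> R)
    (P : probability (path_space G) R) : Prop :=
  forall (n : nat) (y : nat -> G),
    P [set x | forall m, (m <= n)%N -> x m = y m] =
    ((y 0%N == 1%g)%:R * \prod_(m < n) mu ((y m)^-1 * y m.+1)%g)%:E.

(** * The Poisson boundary *)

(* Two trajectories are identified when they coincide after some instant, up to
   a time shift. The Poisson boundary is the quotient of the path space by the
   measurable hull of this relation: its measurable sets are the measurable
   sets of trajectories that are saturated (equivalently, shift invariant),
   taken modulo P-null sets, and its measure is the restriction of P. *)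

Definition traj_equiv (G : groupType) (x y : path_space G) : Prop :=
  exists a b : nat, forall n, x (a + n)%N = y (b + n)%N.

Definition boundary_sets (G : groupType) : set (set (path_space G)) :=
  [set A | measurable A /\ forall x y, traj_equiv x y -> A x -> A y].

Definition translate (G : groupType) (g : G) (x : path_space G) :
  path_space G := fun n => (g * x n)%g.

(* The boundary is a point modulo null sets. *)
Definition liouville (R : realType) (G : groupType)
    (P : probability (path_space G) R) : Prop :=
  forall A, boundary_sets A -> P A = 0%E \/ P A = 1%E.

(* [g] fixes almost every point of the boundary, i.e. fixes each of its
   measurable sets modulo null sets. *)
Definition acts_trivially (R : realType) (G : groupType)
    (P : probability (path_space G) R) (g : G) : Prop :=
  forall A, boundary_sets A -> P (A `+` (translate g @` A)) = 0%E.

(** * Cautiousness and the span function *)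

Definition cautious (R : realType) (K : groupType) (S : set K) (f : nat -> R)
    (Q : probability (path_space K) R) : Prop :=
  forall eps : R, 0 < eps ->
    (0%E < limn_esup (fun n : nat =>
       Q [set x | (\max_(1 <= m < n.+1) wlen S (x m))%N%:R / f n < eps]%R))%E.

(* [h = k(t)] for the action of K on the abelian group H by conjugation in G. *)
Definition conj_image (H G K : groupType) (i : {multiplicative H -> G})
    (p : {multiplicative G -> K}) (k : K) (t h : H) : Prop :=
  exists2 g : G, p g = k & i h = (g * i t * g^-1)%g.

Definition span_gen (R : realType) (H G K : groupType)
    (i : {multiplicative H -> G}) (p : {multiplicative G -> K})
    (S : set K) (T : set H) (r : R) : set H :=
  [set h | exists (k : K) (t : H),
     [/\ (wlen S k)%:R <= r, T t & conj_image i p k t h]].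

Definition span_set (R : realType) (H G K : groupType)
    (i : {multiplicative H -> G}) (p : {multiplicative G -> K})
    (S : set K) (T : set H) (r : R) (n : nat) : set H :=
  [set h | exists s : seq H,
     [/\ (size s <= n)%N, (forall x, x \in s -> span_gen i p S T r x)
       & h = (\prod_(x <- s) x)%g]].

Definition Span (R : realType) (H G K : groupType)
    (i : {multiplicative H -> G}) (p : {multiplicative G -> K})
    (S : set K) (T : set H) (r : R) (n : nat) : \bar R :=
  counting (span_set i p S T r n).

Definition small_span (R : realType) (H G K : groupType)
    (i : {multiplicative H -> G}) (p : {multiplicative G -> K})
    (S : set K) (f : nat -> R) (T : set H) : Prop :=
  forall eps : R, 0 < eps -> exists delta C : R,
    [/\ 0 < delta, 0 < C
      & forall n : nat,
          (Span i p S T (delta * f n) n <= (C * (1 + eps) ^+ n)%:E)%E].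

(* Main.v *)
Require Import Defs.
From mathcomp Require Import all_boot all_order all_algebra.
From mathcomp Require Import all_classical all_reals all_analysis.
From mathcomp Require Import ring lra.
Import Order.TTheory GRing.Theory Num.Theory.
Local Open Scope classical_set_scope.
Local Open Scope ring_scope.

(** For a measurable set A of the Poisson boundary of (G, mu), let u(g) be the
probability that the walk started at g ends in A. The function u is harmonic
and determines A modulo null sets. Both parts follow from one fact: if {h} has
small span, then u(hg) = u(g) for every g ([harmonic_span_invariant]).

This is proved with entropy. Suppose u(hg) and u(g) differ. By non-degeneracy
g and hg are values of words, of lengths a and b, in the support of mu. The
function u is also harmonic for the half-sum of the a-th and b-th convolution
powers of mu, and that law gives mass at least some q > 0 to both g and hg.
One of its steps can thus be sampled as follows: with probability 2q make a
switch, that is, toss a fair coin to choose between g and hg; otherwise draw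
from what is left of the law. Freeze everything except the coins. The position
at time n is then uniform on a finite list of elements of G; let Phi_n be its
entropy, a random variable depending on the frozen data.

- Phi is subadditive under concatenation of the data, and bounded by n ln 2.
- Its mean grows linearly ([quenched_entropy_growth]). Prepending a switch
  replaces the law of the position by the mean of two of its translates, and
  integrating u against these translates gives u(g) and u(hg) on average; two
  laws that a bounded function tells apart have a mixture of larger entropy
  ([seq_entropy_cat_ge]).
- A weak form of Kingman's theorem ([subadditive_mean_concentration]) turns
  this into Phi_n >= kappa n / 2 with probability tending to 1, for a fixed
  kappa > 0.
- On the other hand g and hg have the same image in K, so the projected walk
  does not see the coins. Moving all the factors h to the left writes the
  position as a product of at most n conjugates of h, by elements that the
  projected walk visits, times an element fixed by the data
  ([products_in_span]). If the projected walk stays in the ball of radius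
  delta f(n), this leaves at most C (1 + eps)^n positions, so that
  Phi_n <= ln C + eps n. By cautiousness this happens with probability at
  least some c > 0 for infinitely many n: a contradiction for eps small.

Part 2: once u is invariant under h, the sets A and hA meet every cylinder in
the same mass, so that they agree modulo a null set
([boundary_fun_determines]).

Part 1: every {t} with t in T has small span, so u is invariant under the
group H generated by T and factors through K. Visiting {u > 1/2} infinitely
often is then a boundary event of the walk on K, of probability 0 or 1. If
u(X_n) >= 1/2 infinitely often almost surely, then splitting according to the
first such visit shows that A has conditional probability at least 1/2 given
any cylinder, and hence P(A) = 1 ([recurrent_boundary_full]). The other case
is the same statement for the complement of A. *)

Set Implicit Arguments.
Unset Strict Implicit.
Unset Printing Implicit Defensive.

(** * Entropy of finite lists *)

Section Entropy.
Context {R : realType} {T : choiceType}.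
Implicit Types (s t U : seq T) (v : T -> R).

Definition avg s v : R := (\sum_(x <- s) v x) / (size s)%:R.

(** The Shannon entropy of the law of a uniformly random entry of [s]. Working
    with lists keeps the laws finite and makes mixtures of two laws of equal
    weight concatenations. *)
Definition seq_entropy s : R := avg s (fun x => ln ((size s)%:R / (count_mem x s)%:R)).

Lemma ln_ge_tangent (c y : R) : 0 < c -> 0 < y -> ln c + 1 - c / y <= ln y.
Proof.
move=> c0 y0; have cy0 : 0 < c / y by rewrite divr_gt0.
have := @le_ln1Dx R (c / y - 1).
have -> : 1 + (c / y - 1) = c / y by ring.
rewrite ln_div ?posrE// => H; have := H _; lra.
Qed.

Lemma ln1D_ge_quadratic (w : R) : `|w| <= 2^-1 -> w - 2 * w ^+ 2 <= ln (1 + w).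
Proof.
rewrite ler_norml => /andP[w1 w2].
have w0 : 0 < 1 + w by lra.
have := ln_ge_tangent (ltr01) w0; rewrite ln1 add0r; apply: le_trans.
rewrite -(ler_pM2r w0) [in leRHS]mulrBl mulfVK ?gt_eqF//.
have : 0 <= w ^+ 2 * (1 + 2 * w) by rewrite mulr_ge0 ?sqr_ge0//; lra.
move=> H.
have -> : (1 * (1 + w) - 1) = (w - 2 * w ^+ 2) * (1 + w) + w ^+ 2 * (1 + 2 * w) by ring.
lra.
Qed.

(** Summing over a common duplicate-free list [U] allows sums over different
    lists to be compared term by term. *)
Lemma sum_count s U v : uniq U -> {subset s <= U} ->
  \sum_(x <- s) v x = \sum_(x <- U) (count_mem x s)%:R * v x.
Proof.
move=> uU; elim: s => [|y s IH] sU.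
  by rewrite big_nil big1// => i _; rewrite mul0r.
rewrite big_cons IH; last by move=> z zs; apply: sU; rewrite inE zs orbT.
rewrite (bigD1_seq y) ?sU ?mem_head//= [in RHS](bigD1_seq y) ?sU ?mem_head//=.
rewrite eqxx natrD mulrDl mul1r addrA; congr (_ + _).
by apply: eq_bigr => z zy; rewrite eq_sym (negbTE zy).
Qed.

Lemma natr_gt0_size s : (0 < size s)%N -> 0 < (size s)%:R :> R.
Proof. by rewrite ltr0n. Qed.

Lemma count_gt0 s x : x \in s -> 0 < (count_mem x s)%:R :> R.
Proof. by move=> xs; rewrite ltr0n -has_count has_pred1. Qed.

Lemma ler_avg s v v' : (forall x, x \in s -> v x <= v' x) -> avg s v <= avg s v'.
Proof.
move=> vv'; rewrite /avg ler_wpM2r ?invr_ge0//.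
by rewrite big_seq [leRHS]big_seq; apply: ler_sum.
Qed.

Lemma avgD s v v' : avg s (fun x => v x + v' x) = avg s v + avg s v'.
Proof. by rewrite /avg big_split mulrDl. Qed.

Lemma avgZ s c v : avg s (fun x => c * v x) = c * avg s v.
Proof. by rewrite /avg -mulr_sumr mulrA. Qed.

Lemma avg_cst s c : (0 < size s)%N -> avg s (fun=> c) = c.
Proof.
move=> s0; rewrite /avg big_const_seq count_predT iter_addr addr0 -[c *+ _]mulr_natr.
by rewrite mulfK// pnatr_eq0 -lt0n.
Qed.

Lemma seq_entropy_ge0 s : 0 <= seq_entropy s.
Proof.
rewrite /seq_entropy /avg divr_ge0// big_seq sumr_ge0// => x xs.
rewrite ln_ge0// ler_pdivlMr ?count_gt0// mul1r ler_nat count_size//.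
Qed.

(** The uniform law maximizes entropy: bound ln (N / c) by its tangent at M,
    where c is the multiplicity of an entry; the error terms cancel on
    average. *)
Lemma seq_entropy_le_ln_card s (M : nat) : (0 < size s)%N -> (size (undup s) <= M)%N ->
  seq_entropy s <= ln M%:R.
Proof.
move=> s0 uM; have N0 := natr_gt0_size s0.
have M0 : 0 < M%:R :> R.
  rewrite ltr0n; apply: leq_trans uM.
  have [x xs] : exists x, x \in s by case: (s) s0 => // x s' _; exists x; rewrite mem_head.
  by case: (undup s) (mem_undup s x) => //; rewrite xs.
have h x : x \in s -> ln ((size s)%:R / (count_mem x s)%:R) <=
    (ln M%:R - 1) + (size s)%:R / M%:R * (count_mem x s)%:R^-1 :> R.
  move=> xs; have c0 := count_gt0 xs.
  have y0 : 0 < (size s)%:R / (count_mem x s)%:R :> R by rewrite divr_gt0.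
  set y := _ / _ in y0 *.
  have y1 : 0 < y / M%:R by rewrite divr_gt0.
  have := ln_ge_tangent y1 ltr01; rewrite ln1 divr1 ln_div ?posrE// /y.
  have -> : (size s)%:R / M%:R / (count_mem x s)%:R = (size s)%:R / (count_mem x s)%:R / M%:R :> R by rewrite mulrAC.
  move=> H; lra.
apply: le_trans (ler_avg h) _; rewrite avgD avg_cst// avgZ.
suff : (size s)%:R / M%:R * avg s (fun x => (count_mem x s)%:R^-1) <= 1 by lra.
have E : \sum_(x <- s) ((count_mem x s)%:R^-1 : R) = (size (undup s))%:R.
  rewrite (@sum_count s (undup s)) ?undup_uniq//; last by move=> x; rewrite mem_undup.
  rewrite big_seq (eq_bigr (fun=> 1)); last first.
    by move=> x; rewrite mem_undup => xs; rewrite divff// gt_eqF// count_gt0.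
  by rewrite -big_seq big_const_seq count_predT iter_addr addr0.
rewrite /avg E; have -> : (size s)%:R / M%:R * ((size (undup s))%:R / (size s)%:R) =
    (size (undup s))%:R / M%:R :> R.
  by field; rewrite !gt_eqF.
by rewrite ler_pdivrMr// mul1r ler_nat.
Qed.

(** The entropy of a mixture exceeds the mean entropy by the mutual information
    between the position and the choice of the component. This is bounded below
    as in the Donsker-Varadhan formula, testing the first law with
    1 + sg * v and the second with 1 - sg * v. The term linear in [sg] detects
    any difference between the means of [v]; the loss is only quadratic, so a
    small [sg] of the right sign gives a definite gain. *)
Lemma seq_entropy_cat_ge s t v (sg : R) : (0 < size s)%N -> size t = size s ->
  (forall x, `|v x| <= 1) -> `|sg| <= 2^-1 ->
  (seq_entropy s + seq_entropy t) / 2 + sg / 2 * (avg s v - avg t v) - 2 * sg ^+ 2 <=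
  seq_entropy (s ++ t).
Proof.
move=> s0 ts v1 sg1; have N0 := natr_gt0_size s0.
pose a x : R := (count_mem x s)%:R; pose b x : R := (count_mem x t)%:R.
pose U := undup (s ++ t).
have uU : uniq U by rewrite undup_uniq.
have sU : {subset s <= U} by move=> x xs; rewrite mem_undup mem_cat xs.
have tU : {subset t <= U} by move=> x xt; rewrite mem_undup mem_cat xt orbT.
have sv x : `|sg * v x| <= 2^-1.
  rewrite normrM; apply: le_trans (ler_piMr _ (v1 x)) sg1; exact: normr_ge0.
(* [e] stands for [sg * v x] on [s] and for its opposite on [t], and [c] for the
   multiplicity of [x] in the list at hand. *)
have key (c : R) (x : T) (e : R) : 0 < c -> 0 < a x + b x -> `|e| <= 2^-1 -> `|e| <= `|sg| ->
   ln ((size s)%:R / c) + e - 2 * sg ^+ 2 + 1 - (1 + e) * ((a x + b x) / 2) * c^-1 <=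
   ln ((size (s ++ t))%:R / (count_mem x (s ++ t))%:R) :> R.
  move=> c0 ab0 e1 esg.
  have -> : (size (s ++ t))%:R / (count_mem x (s ++ t))%:R =
      (size s)%:R / c * (2 * c / (a x + b x)) :> R.
    rewrite size_cat count_cat ts !natrD -/(a x) -/(b x).
    by field; apply/andP; split; rewrite gt_eqF.
  rewrite [ln (_ / c * _)]lnM ?posrE ?divr_gt0 ?mulr_gt0//.
  have y0 : 0 < 2 * c / (a x + b x) by rewrite divr_gt0 ?mulr_gt0.
  have w0 : 0 < 1 + e by move: e1; rewrite ler_norml => /andP[? ?]; lra.
  have := ln_ge_tangent w0 y0; have := ln1D_ge_quadratic e1.
  have -> : (1 + e) / (2 * c / (a x + b x)) = (1 + e) * ((a x + b x) / 2) * c^-1.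
    by field; apply/andP; split; rewrite gt_eqF.
  have : e ^+ 2 <= sg ^+ 2.
    by rewrite -(real_normK (num_real e)) -(real_normK (num_real sg)) ler_pXn2r ?nnegrE.
  move=> H1 H2 H3. lra.
have nvsg x : `|sg * v x| <= `|sg| by rewrite normrM ler_piMr.
have ab x : x \in U -> 0 < a x + b x.
  rewrite mem_undup mem_cat => /orP[xs|xt].
    by have := count_gt0 xs; rewrite -/(a x); have : 0 <= b x by []; lra.
  by have := count_gt0 xt; rewrite -/(b x); have : 0 <= a x by []; lra.
have hs x : x \in s -> ln ((size s)%:R / a x) + (sg * v x) + ((1 - 2 * sg ^+ 2) + -1 *
     ((1 + sg * v x) * ((a x + b x) / 2) * (a x)^-1)) <=
   ln ((size (s ++ t))%:R / (count_mem x (s ++ t))%:R) :> R.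
  move=> xs; have := key (a x) x (sg * v x) (count_gt0 xs) (ab x (sU x xs)) (sv x) (nvsg x).
  by apply: le_trans; lra.
have ht x : x \in t -> ln ((size t)%:R / b x) + (- sg * v x) + ((1 - 2 * sg ^+ 2) + -1 *
     ((1 - sg * v x) * ((a x + b x) / 2) * (b x)^-1)) <=
   ln ((size (s ++ t))%:R / (count_mem x (s ++ t))%:R) :> R.
  move=> xt.
  have := key (b x) x (- (sg * v x)) (count_gt0 xt) (ab x (tU x xt)).
  rewrite normrN ts => /(_ (sv x) (nvsg x)).
  by apply: le_trans; lra.
have entE : seq_entropy (s ++ t) =
   (avg s (fun x => ln ((size (s ++ t))%:R / (count_mem x (s ++ t))%:R)) +
    avg t (fun x => ln ((size (s ++ t))%:R / (count_mem x (s ++ t))%:R))) / 2.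
  rewrite /seq_entropy /avg big_cat /= ts size_cat ts natrD.
  by field; rewrite !gt_eqF ?addr_gt0.
have t0 : (0 < size t)%N by rewrite ts.
have := ler_avg hs; have := ler_avg ht; rewrite entE.
rewrite !avgD !avgZ !avg_cst// -/(seq_entropy s) -/(seq_entropy t).
set A := avg s (fun x => ln _); set B := avg t (fun x => ln _).
set X := avg s (fun x => _ / a x); set Y := avg t (fun x => _ / b x).
(* The quotients by the multiplicities turn averages over [s] and [t] into sums
   over [U], where the contributions of [1 + sg * v] and [1 - sg * v] add up to
   a total mass. *)
suff : X + Y <= 2 by rewrite /seq_entropy -/(a _); lra.
have le_pt (c d : R) : 0 <= c -> 0 <= d -> c * (d / c) <= d.
  move=> c0 d0; have [->|cn0] := eqVneq c 0; first by rewrite mul0r.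
  by rewrite mulrCA divff// mulr1.
have XE : X <= (\sum_(x <- U) (1 + sg * v x) * ((a x + b x) / 2)) / (size s)%:R.
  rewrite /X /avg (sum_count _ uU sU) ler_pM2r ?invr_gt0//.
  apply: ler_sum => x _; rewrite -/(a x).
  have := sv x; rewrite ler_norml => /andP[? ?].
  have a0 : 0 <= a x by []. have b0 : 0 <= b x by [].
  by apply: le_pt => //; apply: mulr_ge0; lra.
have YE : Y <= (\sum_(x <- U) (1 - sg * v x) * ((a x + b x) / 2)) / (size s)%:R.
  rewrite /Y /avg (sum_count _ uU tU) ts ler_pM2r ?invr_gt0//.
  apply: ler_sum => x _; rewrite -/(b x).
  have := sv x; rewrite ler_norml => /andP[? ?].
  have a0 : 0 <= a x by []. have b0 : 0 <= b x by [].
  by apply: le_pt => //; apply: mulr_ge0; lra.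
apply: le_trans (lerD XE YE) _; rewrite -mulrDl -big_split /= ler_pdivrMr//.
rewrite (eq_bigr (fun x => a x * 1 + b x * 1)); last by move=> x _; field.
rewrite big_split /= -(sum_count (fun=> 1) uU sU) -(sum_count (fun=> 1) uU tU).
by rewrite !big_const_seq !count_predT !iter_addr !addr0 ts; lra.
Qed.

End Entropy.
Arguments seq_entropy R {T} s.

Lemma avg_map (R : realType) (T T' : choiceType) (f : T -> T') (s : seq T) (v : T' -> R) :
  avg (map f s) v = avg s (v \o f).
Proof. by rewrite /avg size_map big_map. Qed.

Lemma seq_entropy_map (R : realType) (T T' : choiceType) (f : T -> T') (s : seq T) :
  injective f -> seq_entropy R (map f s) = seq_entropy R s.
Proof.
move=> fI; rewrite /seq_entropy avg_map size_map; congr avg; apply/funext => x /=.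
rewrite count_map; congr (ln (_ / _%:R)).
by apply: eq_count => y /=; rewrite inj_eq.
Qed.

Section EntropyGroup.
Context {R : realType} {G : groupType}.
Implicit Types s t : seq G.

Definition mulseq s t := [seq (x * y)%g | x <- s, y <- t].

Lemma avg_mulseq s t (v : G -> R) :
  avg (mulseq s t) v = avg s (fun x => avg t (fun y => v (x * y)%g)).
Proof.
rewrite /avg size_allpairs big_allpairs_dep -mulr_suml natrM invfM mulrA.
by rewrite mulrAC.
Qed.

Lemma count_mulseq_ge s t x y : (count_mem x s * count_mem y t <=
  count_mem (x * y)%g (mulseq s t))%N.
Proof.
elim: s => [|z s IH]//=; rewrite /mulseq /= count_cat mulnDl leq_add//.
have [->|]//= := eqVneq z x; rewrite mul1n count_map; apply/eq_leq/eq_count => w /=.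
by rewrite (inj_eq (mulgI x)).
Qed.

Lemma ln_ratioM_le (N M a b c : R) : 0 < N -> 0 < M -> 0 < a -> 0 < b -> 0 < c ->
  a * b <= c -> ln (N * M / c) <= ln (N / a) + ln (M / b).
Proof.
move=> N0 M0 a0 b0 c0 abc; rewrite -lnM ?posrE ?divr_gt0// ler_ln ?posrE; last 2 first.
- by rewrite divr_gt0// mulr_gt0.
- by rewrite mulr_gt0// divr_gt0.
rewrite [leRHS]mulrACA ler_pM2l ?mulr_gt0// -invfM lef_pV2 ?posrE//.
by rewrite mulr_gt0.
Qed.

(** A product x * y occurs in [mulseq s t] at least as many times as the product
    of the multiplicities of x and y, so its probability is at least the product
    of theirs. *)
Lemma seq_entropy_mulseq s t :
  seq_entropy R (mulseq s t) <= seq_entropy R s + seq_entropy R t.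
Proof.
have [->|] := eqVneq s [::];
  first by rewrite {1}/seq_entropy /avg big_nil mul0r addr_ge0 ?seq_entropy_ge0.
rewrite -size_eq0 -lt0n => s0.
have [->|] := eqVneq t [::].
  rewrite (_ : mulseq s [::] = [::]); last by rewrite /mulseq; elim: (s).
  by rewrite {1}/seq_entropy /avg big_nil mul0r addr_ge0 ?seq_entropy_ge0.
rewrite -size_eq0 -lt0n => t0.
rewrite {1}/seq_entropy avg_mulseq.
have -> : seq_entropy R s + seq_entropy R t = avg s (fun x => avg t (fun y =>
   ln ((size s)%:R / (count_mem x s)%:R) + ln ((size t)%:R / (count_mem y t)%:R))).
  rewrite (_ : (fun x => _) = (fun x => ln ((size s)%:R / (count_mem x s)%:R) + seq_entropy R t)).
    by rewrite avgD avg_cst.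
  by apply/funext => x; rewrite avgD avg_cst.
apply: ler_avg => x xs; apply: ler_avg => y yt.
have cx := @count_gt0 R _ _ _ xs; have cy := @count_gt0 R _ _ _ yt.
have Ns := @natr_gt0_size R _ _ s0; have Nt := @natr_gt0_size R _ _ t0.
have cxy : (0 < count_mem (x * y)%g (mulseq s t))%N.
  apply: leq_trans (count_mulseq_ge s t x y).
  by rewrite muln_gt0; move: cx cy; rewrite !ltr0n => -> ->.
rewrite size_allpairs natrM; apply: ln_ratioM_le => //; first by rewrite ltr0n.
by rewrite -natrM ler_nat count_mulseq_ge.
Qed.

Lemma mulseqA s t u : mulseq s (mulseq t u) = mulseq (mulseq s t) u.
Proof.
rewrite /mulseq; elim: s => [|x s IH]//=; rewrite IH allpairs_cat; congr cat.
elim: t {IH} => [|y t IHt]//=; rewrite map_cat IHt; congr cat.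
by rewrite -map_comp; apply: eq_map => z /=; rewrite mulgA.
Qed.

End EntropyGroup.

(** * Means, iterated means and subadditive concentration *)

Section Mean.
Context {R : realType}.

(** Means below are only controlled on bounded functions; the domain [D] is
    either everything or the sequences of a given length. *)
Definition bounded_on {X : Type} (D : X -> Prop) (F : X -> R) : Prop :=
  exists B, forall x, D x -> `|F x| <= B.

Definition everywhere {X : Type} (x : X) := True.

Lemma bounded_onD X (D : X -> Prop) F F' :
  bounded_on D F -> bounded_on D F' -> bounded_on D (fun x => F x + F' x).
Proof.
move=> [B FB] [B' FB']; exists (B + B') => x Dx.
by apply: le_trans (ler_normD _ _) _; rewrite lerD ?FB ?FB'.
Qed.

Lemma bounded_onM X (D : X -> Prop) F F' :
  bounded_on D F -> bounded_on D F' -> bounded_on D (fun x => F x * F' x).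
Proof.
move=> [B FB] [B' FB']; exists (B * B') => x Dx.
by rewrite normrM ler_pM ?FB ?FB'.
Qed.

Lemma bounded_on_cst X (D : X -> Prop) c : bounded_on D (fun=> c).
Proof. by exists `|c|. Qed.

Lemma bounded_onZ X (D : X -> Prop) c F : bounded_on D F -> bounded_on D (fun x => c * F x).
Proof. exact/bounded_onM/bounded_on_cst. Qed.

Lemma bounded_on_bool X (D : X -> Prop) (b : X -> bool) : bounded_on D (fun x => (b x)%:R).
Proof. by exists 1 => x _; case: (b x); rewrite ?normr1 ?normr0. Qed.

Lemma bounded_on_itv X (D : X -> Prop) F B :
  (forall x, D x -> 0 <= F x <= B) -> bounded_on D F.
Proof. by move=> FB; exists B => x /FB/andP[F0 F1]; rewrite ger0_norm. Qed.

(** An expectation, reduced to its linearity and positivity on bounded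
    functions: in this form a law can be cut into signed pieces, as in
    [switch_mean] below, without handling series. *)
Record is_mean {X : Type} (I : (X -> R) -> R) : Prop := IsMean {
  meanD : forall F F', bounded_on everywhere F -> bounded_on everywhere F' ->
    I (fun x => F x + F' x) = I F + I F';
  meanZ : forall c F, bounded_on everywhere F -> I (fun x => c * F x) = c * I F;
  mean_ge0 : forall F, bounded_on everywhere F -> (forall x, 0 <= F x) -> 0 <= I F;
  mean1 : I (fun=> 1) = 1 }.

Section MeanTheory.
Context {X : Type} {I : (X -> R) -> R}.
Hypothesis mI : is_mean I.

Lemma mean_cst c : I (fun=> c) = c.
Proof.
rewrite (_ : (fun=> c) = fun x => c * (fun=> 1) x); last by apply/funext => x;
  rewrite mulr1.
by rewrite meanZ ?mean1 ?mulr1//; exact: bounded_on_cst.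
Qed.

Lemma mean_le F F' : bounded_on everywhere F -> bounded_on everywhere F' ->
  (forall x, F x <= F' x) -> I F <= I F'.
Proof.
move=> bF bF' FF'; rewrite -subr_ge0.
have -> : I F' - I F = I (fun x => F' x + (-1) * F x).
  by rewrite meanD ?meanZ ?mulN1r//; exact: bounded_onZ.
apply: mean_ge0 => //; first by apply: bounded_onD => //; exact: bounded_onZ.
by move=> x; rewrite mulN1r subr_ge0.
Qed.

Lemma mean_itv F a b : (forall x, a <= F x <= b) -> a <= I F <= b.
Proof.
move=> Fab; have bF : bounded_on everywhere F.
  exists (`|a| + `|b|) => x _; have /andP[] := Fab x.
  have := ler_norm b; have := ler_norm (- a); rewrite normrN.
  have := normr_ge0 a; have := normr_ge0 b.
  by rewrite ler_norml; move=> ? ? ? ? ? ?; apply/andP; split; lra.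
rewrite -[X in X <= I F](mean_cst a) -[X in I F <= X](mean_cst b).
by rewrite !mean_le//; do ?[exact: bounded_on_cst] => x; have /andP[] := Fab x.
Qed.

Lemma mean_norm_le F B : (forall x, `|F x| <= B) -> `|I F| <= B.
Proof. by move=> FB; rewrite ler_norml mean_itv// => x; rewrite -ler_norml. Qed.

End MeanTheory.

Section IteratedMean.
Context {X : Type}.

(** The expectation of a function of [n] independent draws. *)
Fixpoint iter_mean (I : (X -> R) -> R) (n : nat) (F : seq X -> R) : R :=
  if n is m.+1 then I (fun x => iter_mean I m (fun s => F (x :: s))) else F [::].

Definition of_size (n : nat) (s : seq X) := size s = n.

Lemma iter_mean_ext I n F F' : (forall s, size s = n -> F s = F' s) ->
  iter_mean I n F = iter_mean I n F'.
Proof.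
elim: n F F' => [|n IH] F F' FF' /=; first exact: FF'.
by congr I; apply/funext => x; apply: IH => s sn; apply: FF'; rewrite /= sn.
Qed.

Lemma iter_mean_cat I m n F :
  iter_mean I (m + n) F = iter_mean I m (fun s => iter_mean I n (fun t => F (s ++ t))).
Proof.
elim: m F => [|m IH] F //=.
by congr I; apply/funext => x; rewrite IH.
Qed.

Lemma bounded_on_cons n F x :
  bounded_on (of_size n.+1) F -> bounded_on (of_size n) (fun s => F (x :: s)).
Proof. by move=> [B FB]; exists B => s sn; apply: FB; rewrite /of_size /= sn. Qed.

Context {I : (X -> R) -> R}.
Hypothesis mI : is_mean I.

Lemma iter_mean_norm_le n F B : (forall s, size s = n -> `|F s| <= B) ->
  `|iter_mean I n F| <= B.
Proof.
elim: n F => [|n IH] F FB /=; first exact: FB.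
apply: mean_norm_le => // x; apply: IH => s sn; apply: FB; by rewrite /= sn.
Qed.

Lemma bounded_on_iter_mean n F : bounded_on (of_size n.+1) F ->
  bounded_on everywhere (fun x => iter_mean I n (fun s => F (x :: s))).
Proof.
move=> [B FB]; exists B => x _; apply: iter_mean_norm_le => s sn.
by apply: FB; rewrite /of_size /= sn.
Qed.

Lemma iter_meanD n F F' : bounded_on (of_size n) F -> bounded_on (of_size n) F' ->
  iter_mean I n (fun s => F s + F' s) = iter_mean I n F + iter_mean I n F'.
Proof.
elim: n F F' => [|n IH] F F' bF bF' //=.
rewrite -(meanD mI); try exact: bounded_on_iter_mean.
by congr I; apply/funext => x; rewrite IH//; exact: bounded_on_cons.
Qed.

Lemma iter_meanZ n c F : bounded_on (of_size n) F ->
  iter_mean I n (fun s => c * F s) = c * iter_mean I n F.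
Proof.
elim: n F => [|n IH] F bF //=.
rewrite -(meanZ mI); try exact: bounded_on_iter_mean.
by congr I; apply/funext => x; rewrite IH//; exact: bounded_on_cons.
Qed.

Lemma iter_mean_cst n c : iter_mean I n (fun=> c) = c.
Proof.
elim: n => [|n IH] //=; rewrite -[RHS](mean_cst mI c).
by congr I; apply/funext => x; rewrite IH.
Qed.

Lemma iter_mean_le n F F' : bounded_on (of_size n) F -> bounded_on (of_size n) F' ->
  (forall s, size s = n -> F s <= F' s) -> iter_mean I n F <= iter_mean I n F'.
Proof.
elim: n F F' => [|n IH] F F' bF bF' FF' /=; first exact: FF'.
apply: mean_le => //; try exact: bounded_on_iter_mean.
move=> x; apply: IH; try exact: bounded_on_cons.
by move=> s sn; apply: FF'; rewrite /= sn.
Qed.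

Lemma iter_mean_ge0 n F : bounded_on (of_size n) F ->
  (forall s, size s = n -> 0 <= F s) -> 0 <= iter_mean I n F.
Proof.
by move=> bF F0; rewrite -(iter_mean_cst n 0); apply: iter_mean_le => //;
  exact: bounded_on_cst.
Qed.

Lemma iter_mean_itv n F a b : (forall s, size s = n -> a <= F s <= b) ->
  a <= iter_mean I n F <= b.
Proof.
elim: n F => [|n IH] F Fab /=; first exact: Fab.
by apply: mean_itv => // x; apply: IH => s sn; apply: Fab; rewrite /= sn.
Qed.

End IteratedMean.

(** A weak form of Kingman's subadditive ergodic theorem for independent draws:
    a subadditive functional of linearly growing mean is rarely much smaller
    than its mean. Let lambda be the infimum of e n / n, where e n is the mean
    of [phi] over [n] draws, and let M nearly attain it. Cutting k draws into
    blocks of length M bounds [phi] by a sum Z of independent bounded terms,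
    whose mean exceeds e k by little compared with k. So Z - phi is
    nonnegative of small mean, Z is concentrated, and [phi] can only seldom be
    far below. *)
Section WeakKingman.
Context {X : Type} {I : (X -> R) -> R}.
Hypothesis mI : is_mean I.
Variables (phi : seq X -> R) (beta kappa : R).
Hypothesis phi_itv : forall s, 0 <= phi s <= beta * (size s)%:R.
Hypothesis phi_subadditive : forall s t, phi (s ++ t) <= phi s + phi t.
Hypothesis kappa_gt0 : 0 < kappa.
Hypothesis mean_growth : forall n, kappa * n%:R <= iter_mean I n phi.

Let e n := iter_mean I n phi.

Let beta_ge0 : 0 <= beta.
Proof.
have /andP[+ +] : 0 <= e 1 <= beta * 1%:R.
  by apply: iter_mean_itv => // s s1; rewrite -s1.
by rewrite mulr1; exact: le_trans.
Qed.

Let bphi n : bounded_on (of_size n) phi.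
Proof. by apply: (@bounded_on_itv _ _ _ (beta * n%:R)) => s <-; exact: phi_itv. Qed.

Let e_itv n : 0 <= e n <= beta * n%:R.
Proof. by apply: iter_mean_itv => // s s1; rewrite -s1. Qed.

(** The centred sum of [phi] over [q] blocks of length [M] and a last block of
    length [r]. *)
Fixpoint block_dev (M r q : nat) (s : seq X) : R :=
  if q is q'.+1 then (phi (take M s) - e M) + block_dev M r q' (drop M s)
  else phi s - e r.

Let dev_sqr n s : size s = n -> (phi s - e n) ^+ 2 <= (beta * n%:R) ^+ 2.
Proof.
move=> sn; have := phi_itv s; have := e_itv n; rewrite sn => /andP[? ?] /andP[? ?].
rewrite -(real_normK (num_real _)) ler_pXn2r ?nnegrE ?mulr_ge0//.
by rewrite ler_norml; apply/andP; split; lra.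
Qed.

Let bdev n : bounded_on (of_size n) (fun s => phi s - e n).
Proof. by apply: bounded_onD; [exact: bphi|exact: bounded_on_cst]. Qed.

Let mean_dev n : iter_mean I n (fun s => phi s - e n) = 0.
Proof. by rewrite iter_meanD//; [rewrite iter_mean_cst// subrr|exact: bounded_on_cst]. Qed.

Let bounded_block_dev M r q : bounded_on (of_size (q * M + r)) (block_dev M r q).
Proof.
elim: q => [|q [B VB]]; first exact: bdev.
exists ((beta * M%:R) + beta * M%:R + B) => s.
rewrite /of_size mulSn -addnA => sM /=.
have sB : `|block_dev M r q (drop M s)| <= B.
  by apply: VB; rewrite /of_size size_drop sM addnC addnK.
have sT : size (take M s) = M by rewrite size_takel// sM leq_addr.
have := phi_itv (take M s); have := e_itv M; rewrite sT => /andP[? ?] /andP[? ?].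
move: sB; rewrite !ler_norml => /andP[? ?]; apply/andP; split; lra.
Qed.

Let step_cat M r q s t : size s = M ->
  block_dev M r q.+1 (s ++ t) = (phi s - e M) + block_dev M r q t.
Proof. by move=> <- /=; rewrite take_size_cat// drop_size_cat. Qed.

Let mean_block_dev M r q : iter_mean I (q * M + r) (block_dev M r q) = 0.
Proof.
elim: q => [|q IH]; first exact: mean_dev.
rewrite mulSn -addnA iter_mean_cat -[RHS](mean_dev M).
apply: iter_mean_ext => s sM.
rewrite (@iter_mean_ext _ _ _ _ (fun t => (phi s - e M) + block_dev M r q t)); last first.
  by move=> t _; rewrite step_cat.
by rewrite iter_meanD ?IH ?iter_mean_cst ?addr0//; exact: bounded_on_cst.
Qed.

Let var_block_dev M r q : (r <= M)%N ->
  iter_mean I (q * M + r) (fun s => block_dev M r q s ^+ 2) <=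
  q.+1%:R * (beta * M%:R) ^+ 2.
Proof.
move=> rM; elim: q => [|q IH].
  rewrite mul1r; apply: (@le_trans _ _ ((beta * r%:R) ^+ 2)).
    rewrite -[leRHS](iter_mean_cst mI r); apply: iter_mean_le => //; last exact: dev_sqr.
      by under eq_fun do rewrite expr2; apply: bounded_onM; exact: bdev.
    exact: bounded_on_cst.
  by rewrite ler_pXn2r ?nnegrE ?mulr_ge0// ler_wpM2l// ler_nat.
rewrite mulSn -addnA iter_mean_cat.
set V := iter_mean I (q * M + r) _ in IH.
have bV : bounded_on (of_size (q * M + r)) (fun s => block_dev M r q s ^+ 2).
  by under eq_fun do rewrite expr2; apply: bounded_onM; exact: bounded_block_dev.
rewrite (@iter_mean_ext _ _ _ _ (fun s => (phi s - e M) ^+ 2 + V)).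
  rewrite iter_meanD//; last exact: bounded_on_cst.
    rewrite iter_mean_cst// -[q.+2%:R]natr1 mulrDl mul1r addrC lerD//.
    rewrite -[leRHS](iter_mean_cst mI M); apply: iter_mean_le => //; last exact: dev_sqr.
      by under eq_fun do rewrite expr2; apply: bounded_onM; exact: bdev.
    exact: bounded_on_cst.
  by under eq_fun do rewrite expr2; apply: bounded_onM; exact: bdev.
move=> s sM; set d := phi s - e M.
rewrite (@iter_mean_ext _ _ _ _ (fun t => d ^+ 2 + ((2 * d) * block_dev M r q t +
    block_dev M r q t ^+ 2))); last first.
  by move=> t _; rewrite step_cat// -/d; ring.
have bdV : bounded_on (of_size (q * M + r)) (fun t => (2 * d) * block_dev M r q t).
  by apply: bounded_onZ; exact: bounded_block_dev.
rewrite iter_meanD//; [|exact: bounded_on_cst|exact: bounded_onD].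
rewrite iter_meanD// iter_meanZ ?mean_block_dev ?iter_mean_cst ?mulr0 ?add0r//.
Qed.

Let phi_le_block M r q s : phi s <= block_dev M r q s + (q%:R * e M + e r).
Proof.
elim: q s => [|q IH] s /=; first by rewrite mul0r add0r subrK.
have := phi_subadditive (take M s) (drop M s); rewrite cat_take_drop.
have := IH (drop M s); rewrite -[q.+1%:R]natr1; lra.
Qed.

Let deviation M r q (eta : R) : (0 < M)%N -> (r <= M)%N -> 0 < eta ->
  let k := (q * M + r)%N in (M <= k)%N ->
  (forall n, e M / M%:R <= e n.+1 / n.+1%:R + eta) ->
  kappa * k%:R / 2 * iter_mean I k (fun s => (phi s <= kappa * k%:R / 2)%R%:R) <=
  2 * eta * k%:R + (beta * M%:R + 2 * beta ^+ 2 * M%:R / eta).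
Proof.
move=> M0 rM eta0 k Mk Hinf.
have k0 : 0 < k%:R :> R by rewrite ltr0n (leq_trans M0).
have M0' : 0 < M%:R :> R by rewrite ltr0n.
(* The scale at which |V| <= tau + V ^+ 2 / tau is used, to control the first
   moment of V by its variance. *)
pose tau := eta * k%:R; have tau0 : 0 < tau by rewrite mulr_gt0.
pose V := block_dev M r q; pose EZ := q%:R * e M + e r.
have EZk : kappa * k%:R <= EZ.
  rewrite /EZ /k natrD natrM; have := mean_growth M; have := mean_growth r.
  rewrite -/(e r) -/(e M) => h1 h2.
  have : q%:R * (kappa * M%:R) <= q%:R * e M by rewrite ler_wpM2l.
  lra.
have bV2 : bounded_on (of_size k) (fun s => V s ^+ 2).
  by under eq_fun do rewrite expr2; apply: bounded_onM; exact: bounded_block_dev.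
have bV : bounded_on (of_size k) V by exact: bounded_block_dev.
rewrite -iter_meanZ//; last exact: bounded_on_bool.
apply: (@le_trans _ _ (iter_mean I k (fun s => (V s + ((-1) * phi s)) +
   (tau^-1 * V s ^+ 2 + (EZ + tau))))).
  apply: iter_mean_le => //.
  - by apply: bounded_onZ; exact: bounded_on_bool.
  - apply: bounded_onD; apply: bounded_onD => //; first exact: bounded_onZ.
      exact: bounded_onZ.
    exact: bounded_on_cst.
  move=> s sk; have := phi_le_block M r q s; rewrite -/V -/EZ => h.
  have h2 : 0 <= V s + tau^-1 * V s ^+ 2 + tau.
    rewrite -(pmulr_rge0 _ tau0) mulrDr mulrDr mulrA divff ?gt_eqF// mul1r.
    have : 0 <= (2 * V s + tau) ^+ 2 by exact: sqr_ge0.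
    have : 0 < tau * tau by rewrite mulr_gt0.
    nra.
  have h3 : 0 <= tau^-1 * V s ^+ 2 by rewrite mulr_ge0 ?sqr_ge0// invr_ge0 ltW.
  case: (leP (phi s)) => /= phile; first by rewrite mulr1; lra.
  by rewrite mulr0; lra.
rewrite iter_meanD//; last 2 first.
- by apply: bounded_onD => //; exact: bounded_onZ.
- by apply: bounded_onD; [exact: bounded_onZ|exact: bounded_on_cst].
rewrite [X in X + _]iter_meanD//; last exact: bounded_onZ.
rewrite [X in _ + X]iter_meanD//; last 2 first.
- exact: bounded_onZ.
- exact: bounded_on_cst.
rewrite iter_mean_cst// !iter_meanZ// mean_block_dev add0r -/(e k).
have H1 : EZ - e k <= eta * k%:R + beta * M%:R.
  have [k' kk'] : exists k', k = k'.+1 by exists k.-1; rewrite prednK// (leq_trans M0).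
  have := Hinf k'; rewrite -kk' => Hk.
  have hM : e M <= (e k / k%:R + eta) * M%:R by rewrite -ler_pdivrMr.
  have hq : q%:R * e M <= q%:R * ((e k / k%:R + eta) * M%:R) by rewrite ler_wpM2l.
  have hr : e r <= beta * M%:R.
    by have /andP[_ h] := e_itv r; apply: le_trans h _; rewrite ler_wpM2l// ler_nat.
  have hle : (e k / k%:R + eta) * (q%:R * M%:R) <= (e k / k%:R + eta) * k%:R.
    rewrite ler_wpM2l//; last by rewrite -natrM ler_nat /k leq_addr.
    by rewrite addr_ge0 ?(ltW eta0)// divr_ge0//; have /andP[] := e_itv k.
  rewrite /EZ; move: hle; rewrite [X in _ <= X]mulrDl divfK ?gt_eqF//; nra.
have H2 : tau^-1 * iter_mean I k (fun s => V s ^+ 2) <= 2 * beta ^+ 2 * M%:R / eta.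
  rewrite ler_pdivrMl// ; apply: le_trans (var_block_dev q rM) _.
  have -> : tau * (2 * beta ^+ 2 * M%:R / eta) = beta ^+ 2 * M%:R * (2 * k%:R).
    by rewrite /tau; field; rewrite gt_eqF.
  have -> : q.+1%:R * (beta * M%:R) ^+ 2 = beta ^+ 2 * M%:R * (q.+1 * M)%:R.
    by rewrite natrM; ring.
  rewrite ler_wpM2l//; first by rewrite mulr_ge0 ?sqr_ge0.
  rewrite -natrM ler_nat mul2n -addnn mulSn leq_add// /k leq_addr//.
rewrite /tau in H2 *; lra.
Qed.

Lemma subadditive_mean_concentration (c : R) : 0 < c -> exists K0 : nat, forall k,
  (K0 <= k)%N -> iter_mean I k (fun s => (phi s <= kappa * k%:R / 2)%R%:R) <= c.
Proof.
move=> c0; pose eta := c * kappa / 8.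
have eta0 : 0 < eta by rewrite divr_gt0// mulr_gt0.
pose E := [set x : R | exists n, x = e n.+1 / n.+1%:R].
have hE : has_inf E.
  split; first by exists (e 1 / 1%:R), 0%N.
  exists 0 => _ [n ->]; rewrite divr_ge0//; by have /andP[] := e_itv n.+1.
have [_ [M' ->] HM] := inf_adherent eta0 hE.
pose M := M'.+1.
have Hinf n : e M / M%:R <= e n.+1 / n.+1%:R + eta.
  apply: (le_trans (ltW HM)); rewrite lerD2r; apply: ge_inf; last by exists n.
  exact: hE.2.
pose C0 := beta * M%:R + 2 * beta ^+ 2 * M%:R / eta.
have ck0 : 0 < c * kappa / 4 by rewrite divr_gt0// mulr_gt0.
have [K1 HK1] : exists K1 : nat, C0 / (c * kappa / 4) < K1%:R.
  by exists (Num.bound `|C0 / (c * kappa / 4)|);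
    rewrite (le_lt_trans (ler_norm _))// archi_boundP.
exists (maxn M K1) => k; rewrite geq_max => /andP[Mk K1k].
have kE := divn_eq k M.
have := @deviation M (k %% M) (k %/ M) eta isT (ltnW (ltn_pmod k (isT : (0 < M)%N))) eta0.
rewrite -kE => /(_ Mk Hinf); set p := iter_mean _ _ _ => H.
have k0 : 0 < k%:R :> R by rewrite ltr0n (leq_trans _ Mk).
have C0k : C0 <= c * kappa / 4 * k%:R.
  rewrite mulrC -ler_pdivrMr//; apply: le_trans (ltW HK1) _; by rewrite ler_nat.
rewrite -(ler_pM2l (_ : 0 < kappa * k%:R / 2)); last by rewrite divr_gt0// mulr_gt0.
apply: (le_trans H); rewrite -/C0.
have -> : kappa * k%:R / 2 * c = 2 * eta * k%:R + c * kappa / 4 * k%:R.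
  by rewrite /eta; field.
by rewrite lerD2l.
Qed.

End WeakKingman.
End Mean.

(** * The path space of a countable group *)

Lemma countable_inj (T : Type) : countable [set: T] <-> exists f : T -> nat, injective f.
Proof.
split=> [/countable_injP [f fI]|[f fI]].
  by exists f => x y; apply: fI; rewrite in_setT.
apply/countable_injP; exists f => x y _ _; exact: fI.
Qed.

Lemma countable_seq (T : Type) : countable [set: T] -> countable [set: seq T].
Proof.
move=> /countable_inj[f fI]; apply/countable_inj.
exists (fun s => pickle (map f s)) => s t /(pcan_inj pickleK).
exact: inj_map.
Qed.

Section PathSpace.
Context {G : groupType}.
Implicit Types (x : path_space G) (y : nat -> G) (A B : set (path_space G)).

Definition cyl n y : set (path_space G) := [set x | forall m, (m <= n)%N -> x m = y m].

Definition adapted n A := forall x x', (forall m, (m <= n)%N -> x m = x' m) -> A x -> A x'.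

Definition shift n x : path_space G := fun k => x (n + k)%N.

Lemma measurable_coord n (B : set G) : measurable ([set x | B (x n)] : set (path_space G)).
Proof. by apply: sub_sigma_algebra; exists n, B. Qed.

Lemma measurable_cyl n y : measurable (cyl n y).
Proof.
rewrite (_ : cyl n y = \bigcap_(m in [set m | (m <= n)%N]) [set x | x m = y m]).
  apply: bigcap_measurable; first by exists 0%N.
  by move=> m _; exact: (measurable_coord m [set y m]).
by apply/seteqP; split => x /= h m; exact: h.
Qed.

Lemma measurable_path_fun d (T : measurableType d) (phi : T -> path_space G) :
  (forall n (B : set G), measurable [set t | B (phi t n)]) -> measurable_fun setT phi.
Proof.
move=> H _ A mA; rewrite setTI; move: A mA.
apply: smallest_sub.
  split=> /=.
  - by rewrite preimage_set0.
  - by move=> A mA; rewrite setTD -preimage_setC; exact: measurableC.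
  - by move=> F mF; rewrite preimage_bigcup; exact: bigcupT_measurable.
by move=> _ [n [B ->]]; exact: H.
Qed.

Lemma measurable_shift n : measurable_fun setT (shift n).
Proof. by apply: measurable_path_fun => m B; exact: measurable_coord. Qed.

Lemma measurable_translate g : measurable_fun setT (@translate G g).
Proof.
by apply: measurable_path_fun => m B; exact: (measurable_coord m [set z | B (g * z)%g]).
Qed.

Hypothesis Gcount : countable [set: G].

Lemma measurable_adapted n A : adapted n A -> measurable A.
Proof.
move=> nA.
rewrite (_ : A = \bigcup_(s : seq G) (if `[< A (nth 1%g s) >] then cyl n (nth 1%g s) else set0)).
  apply: countable_bigcupT_measurable; first exact: countable_seq.
  by move=> s; case: ifP => _ //; exact: measurable_cyl.
apply/seteqP; split => [x Ax|x [s _]].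
  exists (mkseq x n.+1) => //; case: asboolP => [_ m mn|].
    by rewrite nth_mkseq.
  by case; apply: nA Ax => m mn; rewrite nth_mkseq.
by case: asboolP => // As xs; apply: nA As => m mn; rewrite xs.
Qed.

(** Two cylinders are nested or disjoint, so they form a pi-system; it generates
    the sigma-algebra because there are only countably many of them. *)
Lemma path_measure_unique (R : realType) (m1 m2 : {measure set (path_space G) -> \bar R}) :
  m1 setT = m2 setT -> (m1 setT < +oo)%E -> (forall n y, m1 (cyl n y) = m2 (cyl n y)) ->
  forall A, measurable A -> m1 A = m2 A.
Proof.
move=> mT moo mc.
pose D : set (set (path_space G)) :=
  [set A | A = setT \/ A = set0 \/ exists n y, A = cyl n y].
apply: (measure_unique D (fun=> setT)) => //.
- apply/seteqP; split.
    move=> A; apply: smallest_sub; first exact: smallest_sigma_algebra.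
    move=> _ [n [B ->]].
    rewrite (_ : [set x | B (x n)] =
       \bigcup_(s : seq G) (if `[< B (nth 1%g s n) >] then cyl n (nth 1%g s) else set0)).
      apply: (@countable_bigcupT_measurable _ (g_sigma_algebraType D));
        first exact: countable_seq.
      move=> s; apply: sub_sigma_algebra; case: ifP => _; last by right; left.
      by right; right; exists n, (nth 1%g s).
    apply/seteqP; split => [x Bx|x [s _]].
      exists (mkseq x n.+1) => //; case: asboolP => [_ m mn|].
        by rewrite nth_mkseq.
      by case; rewrite nth_mkseq.
    by case: asboolP => // Bs xs; rewrite /= (xs n (leqnn n)).
  apply: smallest_sub.
    exact: (@sigma_algebra_measurable _ (path_space G)).
  by move=> A [->|[->|[n [y ->]]]] //; exact: measurable_cyl.
- move=> A B [->|[->|[n [y ->]]]].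
  + by rewrite setTI.
  + by move=> _; rewrite set0I; right; left.
  + move=> [->|[->|[k [z ->]]]].
    * by rewrite setIT; right; right; exists n, y.
    * by rewrite setI0; right; left.
    * wlog nk : n y k z / (n <= k)%N.
        move=> W; case/orP: (leq_total n k) => h; first exact: W.
        by rewrite setIC; exact: W.
      have [yz|yz] := pselect (forall m, (m <= n)%N -> y m = z m).
        right; right; exists k, z; apply/seteqP; split => [x [_ xz]//|x xz].
        split=> // m mn; rewrite yz// xz//; exact: leq_trans nk.
      right; left; apply/seteqP; split => [x [xy xz]|x []//].
      by case: yz => m mn; rewrite -xy// xz//; exact: leq_trans nk.
- by move=> _; left.
- by rewrite bigcup_const//; exists 0%N.
- by move=> A [->|[->|[n [y ->]]]] //; rewrite !measure0.
Qed.

(** The cells are numbered through an encoding of the prefixes; numbers that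
    encode no prefix give the empty cells. *)
Lemma path_prefix_decomposition (n : nat) : exists F : nat -> set (path_space G),
  [/\ trivIset setT F, \bigcup_k F k = setT &
      forall k, F k = set0 \/ exists y, F k = cyl n y].
Proof.
have /countable_inj[c cI] := countable_seq Gcount.
exists (fun k => [set x | c (mkseq x n.+1) = k]); split.
- by apply/trivIsetP => i j _ _ ij; apply/seteqP; split => x //= [-> /eqP];
  rewrite (negbTE ij).
- by apply/seteqP; split => x // _; exists (c (mkseq x n.+1)).
- move=> k; have [[x cx]|nx] := pselect (exists x : path_space G, c (mkseq x n.+1) = k).
    right; exists x; apply/seteqP; split => z /=.
      move=> cz m mn.
      have /cI e : c (mkseq z n.+1) = c (mkseq x n.+1) by rewrite cz.
      by have := congr1 (fun s => nth 1%g s m) e; rewrite !nth_mkseq.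
    move=> cz; rewrite -cx; congr c; apply: (@eq_from_nth _ 1%g);
      rewrite ?size_mkseq// => m mn.
    by rewrite !nth_mkseq// cz.
  by left; apply/seteqP; split => x //= cx; case: nx; exists x.
Qed.

End PathSpace.

(** * Finite-dimensional laws, the Markov property and harmonic functions *)

Lemma image_measure (R : realType) d d' (T : measurableType d) (T' : measurableType d')
    (m : {measure set T -> \bar R}) (f : T -> T') : measurable_fun setT f ->
  exists m' : {measure set T' -> \bar R}, forall A, m' A = m (f @^-1` A).
Proof. by move=> mf; unshelve eexists (pushforward m f); [exact: mf|]. Qed.

Section PartialProducts.
Context {G : groupType}.
Implicit Types (s w : seq G).

Definition prodg s : G := (\prod_(g <- s) g)%g.

(** The trajectory with increments [s], constant after the last one. *)
Definition partial_prod s : path_space G := fun k => prodg (take k s).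

Lemma prodg_cons g s : prodg (g :: s) = (g * prodg s)%g.
Proof. by rewrite /prodg big_cons. Qed.

Lemma prodg_cat s t : prodg (s ++ t) = (prodg s * prodg t)%g.
Proof. by rewrite /prodg big_cat. Qed.

Lemma prodg_rcons s g : prodg (rcons s g) = (prodg s * g)%g.
Proof. by rewrite /prodg big_rcons. Qed.

Lemma partial_prod0 s : partial_prod s 0 = 1%g.
Proof. by rewrite /partial_prod take0 /prodg big_nil. Qed.

Lemma partial_prodS s m g : (m < size s)%N ->
  ((partial_prod s m)^-1 * partial_prod s m.+1)%g = nth g s m.
Proof. by move=> ms; rewrite /partial_prod (take_nth g ms) prodg_rcons mulKg. Qed.

Lemma partial_prod_catl s t m :
  (m <= size s)%N -> partial_prod (s ++ t) m = partial_prod s m.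
Proof. by move=> ms; rewrite /partial_prod takel_cat. Qed.

Lemma partial_prod_size s : partial_prod s (size s) = prodg s.
Proof. by rewrite /partial_prod take_size. Qed.

End PartialProducts.

Section StepMean.
Context {R : realType} {G : groupType}.
Variables (mu : G -> R) (P : probability (path_space G) R).
Hypothesis P_law : walk_law mu P.
Hypothesis mu_prob : is_prob mu.

Let mu_ge0 g : 0 <= mu g := mu_prob.1 g.

(** The integral of F against [mu]; realizing it on the path space gives its
    linearity for free. *)
Definition step_mean (F : G -> R) : R := \int[P]_x F (x 1%N).

Lemma P_cyl n (y : nat -> G) : P (cyl n y) =
  ((y 0%N == 1%g)%:R * \prod_(m < n) mu ((y m)^-1 * y m.+1)%g)%:E.
Proof. exact: P_law. Qed.

Lemma P_cyl_partial_prod s : P (cyl (size s) (partial_prod s)) = (\prod_(g <- s) mu g)%:E.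
Proof.
rewrite P_cyl partial_prod0 eqxx mul1r (big_nth 1%g) big_mkord; congr (_%:E).
by apply: eq_bigr => m _; rewrite (partial_prodS 1%g).
Qed.

(** Trajectories not starting at 1 form a null set. *)
Lemma P_start A : measurable A -> P A = P (A `&` [set x | x 0%N = 1%g]).
Proof.
move=> mA; have m0 : measurable ([set x | x 0%N = 1%g] : set (path_space G)).
  exact: (measurable_coord 0 [set 1%g]).
have P0 : P [set x | x 0%N = 1%g] = 1%E.
  have := P_cyl 0 (fun=> 1%g); rewrite big_ord0 mulr1 eqxx => <-; congr (P _).
  by apply/seteqP; split => x /= => [h m|->//]; rewrite leqn0 => /eqP ->.
have PC : P (~` [set x | x 0%N = 1%g]) = 0%E.
  by rewrite probability_setC// P0 subee.
rewrite -[in LHS](setIT A) -(setUv [set x : path_space G | x 0%N = 1%g]) setIUr.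
rewrite measureU ?[X in (_ + X)%E](_ : _ = 0%E) ?adde0//.
- apply/eqP; rewrite eq_le measure_ge0 andbT -PC le_measure// ?inE//.
  + by apply: measurableI => //; exact: measurableC.
  + exact: measurableC.
- exact: measurableI.
- by apply: measurableI => //; exact: measurableC.
- by rewrite setIACA setICr setI0.
Qed.

Lemma P_step1 g : P [set x | x 1%N = g] = (mu g)%:E.
Proof.
rewrite P_start; last exact: (measurable_coord 1 [set g]).
have := P_cyl_partial_prod [:: g]; rewrite big_seq1 => <-; congr (P _).
have pp1 : partial_prod [:: g] 1 = g by rewrite /partial_prod /prodg /= big_seq1.
apply/seteqP; split => x /=.
  by move=> [x1 x0] [|[|//]] _; rewrite ?partial_prod0 ?pp1.
by move=> h; rewrite (h 1%N)// pp1 (h 0%N)// partial_prod0.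
Qed.

Lemma step_integrable (F : G -> R) : bounded_on everywhere F ->
  P.-integrable setT (EFin \o (fun x : path_space G => F (x 1%N))).
Proof.
move=> [B FB]; apply: measurable_bounded_integrable => //.
- by rewrite (le_lt_trans (probability_le1 P _))// ltry.
- move=> _ Y mY; rewrite setTI; exact: (measurable_coord 1 (F @^-1` Y)).
- exists B; split; first exact: num_real.
  by move=> M BM x _ /=; apply: (le_trans (FB _ I)); exact: ltW.
Qed.

Lemma step_mean_is_mean : is_mean step_mean.
Proof.
split.
- by move=> F F' bF bF'; rewrite /step_mean RintegralD//; exact: step_integrable.
- by move=> c F bF; rewrite /step_mean RintegralZl//; exact: step_integrable.
- by move=> F bF F0; apply: Rintegral_ge0 => x _.
- by rewrite /step_mean Rintegral_cst//= mul1r (@probability_setT _ _ _ P).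
Qed.

Let mI := step_mean_is_mean.

Lemma step_mean_atom g : step_mean (fun z => (z == g)%:R) = mu g.
Proof.
rewrite /step_mean (_ : (fun x : path_space G => _) = \1_[set x : path_space G | x 1%N = g]).
  rewrite /Rintegral integral_indic//; first by rewrite setIT [X in fine X](P_step1 g).
  exact: (measurable_coord 1 [set g]).
by apply/funext => x; rewrite indicE; congr (nat_of_bool _)%:R; apply/eqP/idP;
  rewrite in_setE.
Qed.

Lemma mean_sum (I : (G -> R) -> R) (T : Type) (L : seq T) (F : T -> G -> R) :
  is_mean I -> (forall t, bounded_on everywhere (F t)) ->
  bounded_on everywhere (fun x => \sum_(t <- L) F t x) /\
  I (fun x => \sum_(t <- L) F t x) = \sum_(t <- L) I (F t).
Proof.
move=> iI bF; elim: L => [|t L [bL IL]].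
  split; first by exists 0 => x _; rewrite big_nil normr0.
  by under eq_fun do rewrite big_nil; rewrite big_nil mean_cst.
split.
  by under eq_fun do rewrite big_cons; exact: bounded_onD.
by under eq_fun do rewrite big_cons; rewrite big_cons (meanD iI)// IL.
Qed.

Let atoms_mean (L : seq G) (F : G -> R) :
  bounded_on everywhere (fun z => \sum_(g <- L) F g * (z == g)%:R) /\
  step_mean (fun z => \sum_(g <- L) F g * (z == g)%:R) = \sum_(g <- L) mu g * F g.
Proof.
have bF t : bounded_on everywhere (fun z => F t * (z == t)%:R).
  by apply: bounded_onZ; exact: bounded_on_bool.
have [b E] := mean_sum L mI bF; split; first exact: b.
rewrite E; apply: eq_bigr => g _; rewrite (meanZ mI);
  [by rewrite step_mean_atom mulrC|exact: bounded_on_bool].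
Qed.

Let sum_atoms (L : seq G) (F : G -> R) z : uniq L ->
  \sum_(g <- L) F g * (z == g)%:R = if z \in L then F z else 0.
Proof.
move=> uL; case: ifP => zL.
  rewrite (bigD1_seq z)//= eqxx mulr1 big1 ?addr0// => g.
  by rewrite eq_sym => /negbTE ->; rewrite mulr0.
rewrite big_seq big1// => g gL; case: eqP => [zg|]; last by rewrite mulr0.
by move: zL; rewrite zg gL.
Qed.

Lemma sum_le_step_mean (L : seq G) (F : G -> R) : uniq L -> bounded_on everywhere F ->
  (forall z, 0 <= F z) -> \sum_(g <- L) mu g * F g <= step_mean F.
Proof.
move=> uL bF F0; have [b <-] := atoms_mean L F.
by apply: mean_le => // z; rewrite sum_atoms//; case: ifP.
Qed.

(** Up to [eps] the mass sits on finitely many points; this reduces integrals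
    against [mu] to finite sums. *)
Lemma mass_tight (eps : R) : 0 < eps ->
  exists2 L : seq G, uniq L & 1 - eps < \sum_(g <- L) mu g.
Proof.
move=> e0; have := mu_prob.2; rewrite /esum => h.
have : ((1 - eps)%:E < ereal_sup [set (\sum_(x \in A) (mu x)%:E)%E | A in fsets [set: G]])%E.
  by rewrite h lte_fin; lra.
move=> /ereal_sup_gt[_ [A [Afin _] <-]]; rewrite fsbig_finite//= sumEFin lte_fin => hA.
by exists (finmap.enum_fset (fset_set A)); [exact: finmap.fset_uniq|exact: hA].
Qed.

(** An upper bound for all finite partial sums bounds the mean, even for signed
    bounded F, since by tightness the rest contributes arbitrarily little. *)
Lemma step_mean_le (F : G -> R) v : bounded_on everywhere F ->
  (forall L : seq G, uniq L -> \sum_(g <- L) mu g * F g <= v) -> step_mean F <= v.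
Proof.
move=> bF H; have [B FB] := bF.
have B0 : 0 <= B by apply: le_trans (FB 1%g I); exact: normr_ge0.
apply/ler_addgt0Pr => e e0.
have eB : 0 < e / (B + 1) by rewrite divr_gt0// ltr_wpDl.
have [L uL hL] := mass_tight eB.
have [b1 E1] := atoms_mean L F; have [b2 E2] := atoms_mean L (fun=> 1).
apply: (@le_trans _ _ (step_mean (fun z => \sum_(g <- L) F g * (z == g)%:R +
   (B + (- B) * \sum_(g <- L) 1 * (z == g)%:R)))).
  apply: mean_le => //.
    by apply: bounded_onD => //; apply: bounded_onD;
      [exact: bounded_on_cst|exact: bounded_onZ].
  move=> z; rewrite !sum_atoms//; have := FB z I; rewrite ler_norml => /andP[_ h].
  by case: ifP => _; rewrite ?mulr1 ?mulr0 ?addr0 ?add0r ?subrr ?addr0.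
rewrite (meanD mI)//; last by apply: bounded_onD;
  [exact: bounded_on_cst|exact: bounded_onZ].
rewrite (meanD mI)//; [|exact: bounded_on_cst|exact: bounded_onZ].
rewrite (meanZ mI)// (mean_cst mI) E1 E2 lerD ?H//.
under eq_bigr do rewrite mulr1.
have : B * (1 - \sum_(g <- L) mu g) <= B * (e / (B + 1)).
  by rewrite ler_wpM2l//; lra.
have : B * (e / (B + 1)) <= e.
  rewrite mulrCA; apply: ler_piMr; first exact: ltW.
  by rewrite ler_pdivrMr; lra.
lra.
Qed.

Lemma P_bigcup_seq_le (L : seq G) (A : G -> set (path_space G)) (label : path_space G -> G)
    (X : set (path_space G)) :
  uniq L -> measurable X -> (forall g, measurable (A g)) ->
  (forall g, A g `<=` X) -> (forall g x, A g x -> label x = g) ->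
  (\sum_(g <- L) P (A g) <= P X)%E.
Proof.
move=> uL mX mA AX An.
suff H : forall X, measurable X ->
    (forall g, g \in L -> A g `<=` X) -> (\sum_(g <- L) P (A g) <= P X)%E.
  by apply: H => // g _; exact: AX.
elim: L uL {X mX AX} => [|g L IH] /= => [_ X mX _|/andP[gL uL] X mX AX].
  by rewrite big_nil.
rewrite big_cons.
have mD : measurable (X `\` A g) by exact: measurableD.
apply: (@le_trans _ _ (P (A g) + P (X `\` A g))%E).
  rewrite leeD2l// IH// => h hL x Ahx; split; first by apply: (AX h) => //;
    rewrite inE hL orbT.
  by move=> Agx; move: gL; rewrite -(An _ _ Agx) (An _ _ Ahx) hL.
rewrite -measureU//; first last.
- by apply/seteqP; split => // x [a [_ na]].
by rewrite setDUK//; apply: AX; rewrite mem_head.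
Qed.

(** One half of [P_adapted], relative to a prefix [w]: each finite set of
    continuations contributes disjoint events. The other half follows by taking
    complements. *)
Lemma iter_mean_le_P n w B : measurable B -> adapted (size w + n) B ->
  (((\prod_(g <- w) mu g) * iter_mean step_mean n (fun s => (`[< B (partial_prod (w ++ s)) >])%:R))%:E
  <= P (cyl (size w) (partial_prod w) `&` B))%E.
Proof.
elim: n w => [|n IH] w mB nB /=.
  rewrite cats0; case: asboolP => [Bw|_]; last by rewrite mulr0 measure_ge0.
  rewrite mulr1 -P_cyl_partial_prod le_measure ?inE//.
  - exact: measurable_cyl.
  - by apply: measurableI => //; exact: measurable_cyl.
  - move=> x xw; split=> //; apply: nB Bw => m; rewrite addn0 => mw.
    by rewrite xw.
set wt := \prod_(g <- w) mu g.
have wt0 : 0 <= wt by rewrite prodr_ge0.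
have mX : measurable (cyl (size w) (partial_prod w) `&` B).
  by apply: measurableI => //; exact: measurable_cyl.
pose Phi s : R := (`[< B (partial_prod (w ++ s)) >])%:R.
have bF : bounded_on everywhere (fun g => iter_mean step_mean n (fun s => Phi (g :: s))).
  by apply: (bounded_on_iter_mean mI); exact: bounded_on_bool.
rewrite -(meanZ mI)//.
have [p Pp] : exists p, P (cyl (size w) (partial_prod w) `&` B) = p%:E.
  exists (fine (P (cyl (size w) (partial_prod w) `&` B))).
  by rewrite fineK// fin_num_measure.
rewrite Pp lee_fin; apply: step_mean_le => [|L uL]; first exact: bounded_onZ.
rewrite -lee_fin -Pp -sumEFin.
pose A g := cyl (size w).+1 (partial_prod (rcons w g)) `&` B.
have mA g : measurable (A g) by apply: measurableI => //; exact: measurable_cyl.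
apply: (@le_trans _ _ (\sum_(g <- L) P (A g))%E); last first.
  apply: (@P_bigcup_seq_le L A (fun x => (x (size w))^-1 * x (size w).+1)%g) => //.
  - move=> g x [xw Bx]; split=> // m mw; rewrite xw; last exact: leq_trans mw _.
    by rewrite -cats1 partial_prod_catl.
  - move=> g x [xw _]; rewrite !xw// (partial_prodS g) ?size_rcons//.
    by rewrite nth_rcons ltnn eqxx.
apply: lee_sum => g _.
  have := IH (rcons w g) mB; rewrite size_rcons addSnnS => /(_ nB).
  rewrite -cats1 big_cat big_seq1 /= -/wt.
  rewrite (@iter_mean_ext _ _ _ _ _ (fun s => `[< B (partial_prod (w ++ g :: s)) >]%:R));
    last first.
    by move=> s _; rewrite -catA.
  by rewrite /A -cats1 mulrCA mulrA.
Qed.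

Lemma P_adapted n B : measurable B -> adapted n B ->
  P B = (iter_mean step_mean n (fun s => (`[< B (partial_prod s) >])%:R))%:E.
Proof.
move=> mB nB.
have half C : measurable C -> adapted n C ->
    ((iter_mean step_mean n (fun s => (`[< C (partial_prod s) >])%:R))%:E <= P C)%E.
  move=> mC nC; have := @iter_mean_le_P n [::] C mC nC; rewrite big_nil mul1r => h.
  apply: (le_trans h); rewrite le_measure ?inE//.
  by apply: measurableI => //; exact: measurable_cyl.
apply/eqP; rewrite eq_le half// andbT.
have nBC : adapted n (~` B).
  by move=> x x' xx' nBx Bx'; apply: nBx; apply: nB Bx' => m mn; rewrite xx'.
have := half _ (measurableC mB) nBC; rewrite probability_setC//.
have [p ->] : exists p, P B = p%:E.
  by exists (fine (P B)); rewrite fineK// fin_num_measure.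
rewrite -EFinB !lee_fin => h.
suff : iter_mean step_mean n (fun s => (`[< (~` B) (partial_prod s) >])%:R) =
  1 - iter_mean step_mean n (fun s => (`[< B (partial_prod s) >])%:R) by lra.
rewrite -[X in X - _](iter_mean_cst mI n) -mulN1r -iter_meanZ//;
  last exact: bounded_on_bool.
rewrite -iter_meanD//; [|exact: bounded_on_cst|by apply: bounded_onZ;
  exact: bounded_on_bool].
apply: iter_mean_ext => s _; rewrite asbool_neg; case: asbool;
  rewrite /= ?mulr1 ?mulr0 ?addr0 ?subrr//.
Qed.

Hypothesis Gcount : countable [set: G].

(** Both sides are measures in [A] that agree on cylinders. *)
Lemma markov_property n y A : measurable A ->
  P (cyl n y `&` shift n @^-1` A) = (P (cyl n y) * P (translate (y n) @^-1` A))%E.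
Proof.
move=> mA.
have mC := measurable_cyl n y.
have [c Pc] : exists c : {nonneg R}, P (cyl n y) = c%:num%:E.
  have h : 0 <= fine (P (cyl n y)) by apply: fine_ge0.
  by exists (NngNum h); rewrite /= fineK// fin_num_measure.
have [m1 m1E] := image_measure (mrestr P mC) (measurable_shift n).
have [m2 m2E] := image_measure (mscale c P) (measurable_translate (y n)).
have {}m1E B : m1 B = P (shift n @^-1` B `&` cyl n y) by rewrite m1E.
have {}m2E B : m2 B = (P (cyl n y) * P (translate (y n) @^-1` B))%E by rewrite m2E Pc.
rewrite setIC -m1E -m2E.
have m1T : m1 setT = P (cyl n y).
  by rewrite m1E; congr (P _); apply/seteqP; split => x; [case|].
apply: path_measure_unique => //.
- rewrite m1T m2E -[LHS]mule1; congr (_ * _)%E.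
  by rewrite -(@probability_setT _ _ _ P).
- by rewrite m1T Pc ltry.
move=> k z; rewrite m1E m2E.
have -> : translate (y n) @^-1` (cyl k z) = cyl k (fun m => (y n)^-1 * z m)%g.
  apply/seteqP; split => x h m mk; first by rewrite -(h m mk) /translate mulKg.
  by rewrite /translate (h m mk) mulVKg.
rewrite [X in _ = (_ * X)%E]P_cyl.
have [zy|zy] := eqVneq (z 0%N) (y n); last first.
  rewrite (_ : _ `&` _ = set0).
    rewrite measure0; case: eqP => [e|]; last by rewrite mul0r mule0.
    by move: zy; rewrite -[z 0%N](mulVKg (y n)) e mulg1 eqxx.
  apply/seteqP; split => // x [/(_ 0%N (leq0n _)) h0 /(_ n (leqnn n))].
  by move: h0; rewrite /shift addn0 => -> /eqP; rewrite (negbTE zy).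
rewrite zy mulVg eqxx mul1r.
pose w m := if (m <= n)%N then y m else z (m - n)%N.
have -> : shift n @^-1` cyl k z `&` cyl n y = cyl (n + k) w.
  apply/seteqP; split => x.
    move=> [xz xy] m mk; rewrite /w; case: leqP => mn; first exact: xy.
    have := xz (m - n)%N; rewrite /shift subnKC ?(ltnW mn)// => -> //.
    by rewrite leq_subLR.
  move=> xw; split => m mk.
    have := xw (n + m)%N; rewrite leq_add2l => /(_ mk); rewrite /shift => ->.
    rewrite /w addKn; case: leqP => //; rewrite -{2}(addn0 n) leq_add2l leqn0 => /eqP ->.
    by rewrite addn0 zy.
  by have := xw m; rewrite /w mk => ->//; exact: (leq_trans mk (leq_addr _ _)).
rewrite !P_cyl big_split_ord /= -EFinM -mulrA; congr (_%:E); congr (_ * _).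
congr (_ * _); apply: eq_bigr => m _.
  by rewrite /w ltn_ord (ltnW (ltn_ord m)).
congr mu; rewrite invgM invgK mulgA mulgK /w.
rewrite -addnS !addKn [X in if X then _ else z m.+1](_ : _ = false); last first.
  by rewrite -{2}(addn0 n) leq_add2l.
case: leqP => //; rewrite -{2}(addn0 n) leq_add2l leqn0 => /eqP ->.
by rewrite addn0 zy.
Qed.

Section BoundaryFunction.
Variable A : set (path_space G).
Hypothesis bA : boundary_sets A.

(** The bounded harmonic function attached to the boundary event [A]. *)
Definition boundary_fun (x : G) : R := fine (P (translate x @^-1` A)).

Lemma measurable_translate_preimage (x : G) (B : set (path_space G)) :
  measurable B -> measurable (translate x @^-1` B).
Proof. by move=> mB; rewrite -[X in measurable X]setTI; exact: measurable_translate. Qed.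

Lemma boundary_funE x : P (translate x @^-1` A) = (boundary_fun x)%:E.
Proof.
by rewrite fineK// fin_num_measure//; exact: measurable_translate_preimage bA.1.
Qed.

Lemma boundary_fun_itv x : 0 <= boundary_fun x <= 1.
Proof.
rewrite -!lee_fin -boundary_funE measure_ge0 probability_le1//.
exact: measurable_translate_preimage bA.1.
Qed.

Lemma boundary_shift n : shift n @^-1` A = A.
Proof.
by apply/seteqP; split => x; apply: bA.2; [exists 0%N, n|exists n, 0%N].
Qed.

(** The conditional probability of a boundary event given the first [n] steps is
    its harmonic function at the current position: a boundary event does not
    depend on the past. *)
Lemma P_cyl_boundary n y : P (cyl n y `&` A) = (P (cyl n y) * (boundary_fun (y n))%:E)%E.
Proof. by rewrite -boundary_funE -markov_property ?boundary_shift//; exact: bA.1. Qed.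

End BoundaryFunction.

Lemma boundary_translate (A : set (path_space G)) g :
  boundary_sets A -> boundary_sets (translate g @^-1` A).
Proof.
move=> [mA sA]; split; first exact: measurable_translate_preimage.
by move=> x x' [a [b xx']]; apply: sA; exists a, b => n; rewrite /translate xx'.
Qed.

Lemma boundary_setC (A : set (path_space G)) : boundary_sets A -> boundary_sets (~` A).
Proof.
move=> [mA sA]; split; first exact: measurableC.
by move=> x x' [a [b xx']] nA Ax'; apply: nA; apply: sA Ax'; exists b, a => n; rewrite xx'.
Qed.

Lemma boundary_fun_translate (A : set (path_space G)) g x :
  boundary_fun (translate g @^-1` A) x = boundary_fun A (g * x)%g.
Proof.
rewrite /boundary_fun; congr (fine (P _)); apply/seteqP; split => y; rewrite /translate /=.
  by rewrite (_ : (fun n => g * (x * y n))%g = (fun n => g * x * y n)%g)//;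
    apply/funext => n; rewrite mulgA.
by rewrite (_ : (fun n => g * (x * y n))%g = (fun n => g * x * y n)%g)//;
  apply/funext => n; rewrite mulgA.
Qed.

Lemma boundary_funC A x : boundary_sets A -> boundary_fun (~` A) x = 1 - boundary_fun A x.
Proof.
move=> bA; apply: EFin_inj; rewrite EFinB -!boundary_funE//; last exact: boundary_setC.
by rewrite preimage_setC probability_setC//; exact: measurable_translate_preimage bA.1.
Qed.

Lemma boundary_fun1 (A : set (path_space G)) :
  measurable A -> boundary_fun A 1%g = fine (P A).
Proof.
move=> mA; rewrite /boundary_fun; congr (fine (P _)).
by apply/seteqP; split => x; rewrite /translate /=;
  rewrite (_ : (fun n => 1 * x n)%g = x)//; apply/funext => n; rewrite mul1g.
Qed.

(** Conditioning on finitely many values of the first step gives one inequality;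
    the complement of [A] gives the other. *)
Lemma boundary_fun_harmonic A x : boundary_sets A ->
  step_mean (fun g => boundary_fun A (x * g)%g) = boundary_fun A x.
Proof.
have bb B : boundary_sets B -> bounded_on everywhere (fun g => boundary_fun B (x * g)%g).
  by move=> bB; apply: (@bounded_on_itv _ _ _ _ 1) => g _; exact: boundary_fun_itv.
suff half B : boundary_sets B -> step_mean (fun g => boundary_fun B (x * g)%g) <= boundary_fun B x.
  move=> bA; apply/eqP; rewrite eq_le half//=.
  have := half _ (boundary_setC bA).
  under [X in step_mean X]eq_fun do rewrite boundary_funC// -mulN1r.
  rewrite boundary_funC// (meanD mI); [|exact: bounded_on_cst|by apply: bounded_onZ;
    exact: bb].
  by rewrite (meanZ mI) ?(mean_cst mI)//; [lra|exact: bb].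
move=> bB; apply: step_mean_le; first exact: bb.
move=> L uL; set C := translate x @^-1` B.
have bC : boundary_sets C by exact: boundary_translate.
rewrite -lee_fin -boundary_funE// -sumEFin -/C.
apply: (@le_trans _ _ (\sum_(g <- L) P (cyl 1 (partial_prod [:: g]) `&` C))%E).
  apply: lee_sum => g _; rewrite P_cyl_boundary// (P_cyl_partial_prod [:: g]) big_seq1.
  rewrite (partial_prod_size [:: g]) /prodg big_seq1 boundary_fun_translate.
  by rewrite EFinM.
apply: (@P_bigcup_seq_le L _ (fun z => z 1%N)) => //.
- exact: bC.1.
- by move=> g; apply: measurableI; [exact: measurable_cyl|exact: bC.1].
- by move=> g z [-> // _]; rewrite (partial_prod_size [:: g]) /prodg big_seq1.
Qed.

End StepMean.
(** * Switches and their quenched entropy *)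

Section WordMean.
Context {R : realType} {G : groupType}.
Variables (I : (G -> R) -> R).
Hypothesis mI : is_mean I.

Definition word_mean n (F : G -> R) : R := iter_mean I n (fun s => F (prodg s)).

Lemma bounded_on_prodg n (F : G -> R) :
  bounded_on everywhere F -> bounded_on (of_size n) (fun s => F (prodg s)).
Proof. by move=> [B FB]; exists B => s _; exact: FB. Qed.

Lemma word_mean_is_mean n : is_mean (word_mean n).
Proof.
split.
- by move=> F F' bF bF'; rewrite /word_mean iter_meanD//; exact: bounded_on_prodg.
- by move=> c F bF; rewrite /word_mean iter_meanZ//; exact: bounded_on_prodg.
- move=> F bF F0; rewrite /word_mean; apply: iter_mean_ge0 => //; exact: bounded_on_prodg.
- exact: iter_mean_cst.
Qed.

Lemma word_mean_harmonic n (u : G -> R) x : (forall x, I (fun g => u (x * g)%g) = u x) ->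
  word_mean n (fun g => u (x * g)%g) = u x.
Proof.
move=> hu; elim: n x => [|n IH] x; rewrite /word_mean /=.
  by rewrite /prodg big_nil mulg1.
rewrite -[RHS]hu; congr I; apply/funext => g.
rewrite -IH; apply: iter_mean_ext => s _; by rewrite prodg_cons mulgA.
Qed.

Lemma word_mean_ge_atom (mu : G -> R) (w : seq G) (F : G -> R) :
  (forall g, 0 <= mu g) ->
  (forall F g, bounded_on everywhere F -> (forall x, 0 <= F x) -> mu g * F g <= I F) ->
  bounded_on everywhere F -> (forall x, 0 <= F x) ->
  \prod_(g <- w) mu g * F (prodg w) <= word_mean (size w) F.
Proof.
move=> mu0 muI; elim: w F => [|g w IH] F bF F0; rewrite /word_mean /=.
  by rewrite big_nil mul1r.
have bF' : bounded_on everywhere (fun x => word_mean (size w) (fun y => F (x * y)%g)).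
  have [B FB] := bF; exists B => x _; apply: iter_mean_norm_le => // s _; exact: FB.
rewrite big_cons prodg_cons -mulrA.
apply: (@le_trans _ _ (mu g * word_mean (size w) (fun y => F (g * y)%g))).
  rewrite ler_wpM2l//; apply: IH => //.
  by have [B FB] := bF; exists B => x _; exact: FB.
apply: (@le_trans _ _ (I (fun x => word_mean (size w) (fun y => F (x * y)%g)))).
  apply: (muI (fun x => word_mean (size w) (fun y => F (x * y)%g))) => // x.
  apply: iter_mean_ge0 => //.
  by have [B FB] := bF; exists B => y _; exact: FB.
rewrite le_eqVlt; apply/orP; left; apply/eqP; congr I; apply/funext => x.
by apply: iter_mean_ext => s _; rewrite prodg_cons.
Qed.

(** Words for the two elements to be switched may have incompatible lengths, for
    instance of different parity for a bipartite walk. Mixing two convolution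
    powers charges both elements, and keeps all bounded harmonic functions. *)
Definition mixed_mean a b (F : G -> R) : R := (word_mean a F + word_mean b F) / 2.

Lemma mixed_mean_is_mean a b : is_mean (mixed_mean a b).
Proof.
have ma := word_mean_is_mean a; have mb := word_mean_is_mean b.
split; rewrite /mixed_mean.
- by move=> F F' bF bF'; rewrite (meanD ma)// (meanD mb)//; lra.
- by move=> c F bF; rewrite (meanZ ma)// (meanZ mb)//; lra.
- by move=> F bF F0; have := mean_ge0 ma bF F0; have := mean_ge0 mb bF F0; lra.
- by rewrite (mean1 ma) (mean1 mb); lra.
Qed.

End WordMean.

Section Switch.
Context {R : realType} {G : groupType}.
Variables (I : (G -> R) -> R) (g1 g2 : G) (q : R).
Hypothesis mI : is_mean I.
Hypothesis q_gt0 : 0 < q.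
Hypothesis q_le : forall F, bounded_on everywhere F -> (forall x, 0 <= F x) ->
  q * F g1 + q * F g2 <= I F.

(** A step of the law [I] drawn in two stages. The letter [None], of weight 2q,
    is a switch: a coin toss between [g1] and [g2] yet to be made. The letter
    [Some x] is the step [x], drawn from what remains of [I] after mass q has
    been taken away at both [g1] and [g2]. *)
Definition switch_mean (F : option G -> R) : R :=
  2 * q * F None + (I (fun x => F (Some x)) - q * F (Some g1) - q * F (Some g2)).

Lemma switch_mean_is_mean : is_mean switch_mean.
Proof.
have bS (F : option G -> R) : bounded_on everywhere F -> bounded_on everywhere (fun x : G => F (Some x)).
  by move=> [B FB]; exists B => x _; exact: FB.
split; rewrite /switch_mean.
- by move=> F F' bF bF'; rewrite (meanD mI); [lra|exact: bS|exact: bS].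
- by move=> c F bF; rewrite (meanZ mI); [lra|exact: bS].
- move=> F bF F0; have := q_le (bS F bF) (fun x => F0 (Some x)).
  have : 0 <= q * F None by rewrite mulr_ge0// ltW.
  lra.
- by rewrite (mean1 mI); lra.
Qed.

Let mIO := switch_mean_is_mean.

Definition letter (o : option G) : seq G := if o is Some x then [:: x] else [:: g1; g2].

(** The step when all coins show [g1]. *)
Definition base (o : option G) : G := if o is Some x then x else g1.

(** All the values that the product of the letters takes, with multiplicities,
    when the coins vary: a uniform entry is the position given the letters. *)
Fixpoint products (b : seq (option G)) : seq G :=
  if b is o :: b' then mulseq (letter o) (products b') else [:: 1%g].

Lemma mulseq1s (x : G) s : mulseq [:: x] s = [seq (x * y)%g | y <- s].
Proof. by rewrite /mulseq /= cats0. Qed.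

Lemma mulseq2s (x y : G) s :
  mulseq [:: x; y] s = [seq (x * z)%g | z <- s] ++ [seq (y * z)%g | z <- s].
Proof. by rewrite /mulseq /= cats0. Qed.

Lemma products_cat b b' : products (b ++ b') = mulseq (products b) (products b').
Proof.
elim: b => [|o b IH] /=; last by rewrite IH mulseqA.
by rewrite mulseq1s; under eq_map do rewrite mul1g; rewrite map_id.
Qed.

Lemma size_products_gt0 b : (0 < size (products b))%N.
Proof. by elim: b => [|[x|] b IH] //=; rewrite size_allpairs muln_gt0 IH. Qed.

(** The conditional entropy of the position given the letters. *)
Definition quenched_entropy b : R := seq_entropy R (products b).

Lemma quenched_entropy_subadditive b b' :
  quenched_entropy (b ++ b') <= quenched_entropy b + quenched_entropy b'.
Proof. by rewrite /quenched_entropy products_cat; exact: seq_entropy_mulseq. Qed.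

Lemma quenched_entropy_itv b : 0 <= quenched_entropy b <= ln 2 * (size b)%:R.
Proof.
rewrite seq_entropy_ge0 /=; elim: b => [|o b IH].
  by have := @seq_entropy_le_ln_card R _ [:: 1%g : G] 1 isT isT; rewrite ln1 mulr0.
rewrite /= -[(size b).+1%:R]natr1 mulrDr mulr1 addrC;
  apply: (le_trans (seq_entropy_mulseq _ _)); rewrite lerD//.
by apply: (@seq_entropy_le_ln_card _ _ _ 2); [case: o|apply: leq_trans (size_undup _) _;
  case: o].
Qed.

Variable u : G -> R.
Hypothesis u_itv : forall x, 0 <= u x <= 1.
Hypothesis u_harmonic : forall x, I (fun g => u (x * g)%g) = u x.

Let u_norm x : `|u x| <= 1.
Proof. by have /andP[h ?] := u_itv x; rewrite ger0_norm. Qed.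

Let avg_itv b x : 0 <= avg (products b) (fun y => u (x * y)%g) <= 1.
Proof.
have s0 := size_products_gt0 b.
have := @ler_avg R _ (products b) (fun=> 0) (fun y => u (x * y)%g).
have := @ler_avg R _ (products b) (fun y => u (x * y)%g) (fun=> 1).
rewrite !avg_cst// => le1 ge0; apply/andP; split.
  by apply: ge0 => y _; have /andP[] := u_itv (x * y)%g.
by apply: le1 => y _; have /andP[] := u_itv (x * y)%g.
Qed.

Let bavg n x : bounded_on (of_size n) (fun b => avg (products b) (fun y => u (x * y)%g)).
Proof. by apply: (@bounded_on_itv _ _ _ _ 1) => b _; exact: avg_itv. Qed.

(** Drawing the letters and then the coins restores a walk of law [I], for which
    [u] is harmonic. *)
Lemma mean_avg_products n x :
  iter_mean switch_mean n (fun b => avg (products b) (fun y => u (x * y)%g)) = u x.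
Proof.
elim: n x => [|n IH] x /=.
  by rewrite /avg big_seq1 /= mulg1 divr1.
have E o : iter_mean switch_mean n (fun b => avg (mulseq (letter o) (products b)) (fun y => u (x * y)%g))
   = avg (letter o) (fun z => u (x * z)%g).
  case: o => [z|] /=.
    rewrite /avg /= big_seq1 divr1 -IH; apply: iter_mean_ext => b _.
    rewrite mulseq1s size_map big_map /avg; congr (_ / _).
    by apply: eq_bigr => y _; rewrite mulgA.
  rewrite (@iter_mean_ext _ _ _ _ _ (fun b => 2^-1 * avg (products b) (fun y => u (x * g1 * y)%g)
     + 2^-1 * avg (products b) (fun y => u (x * g2 * y)%g))); last first.
    move=> b _; rewrite avg_mulseq /avg big_cons big_seq1 /= mulrDl !(mulrC 2^-1).
    by congr (_ / _ / _ + _ / _ / _); apply: eq_bigr => y _; rewrite mulgA.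
  rewrite iter_meanD//; try by apply: bounded_onZ; exact: bavg.
  rewrite !iter_meanZ ?IH//; try exact: bavg.
  by rewrite /avg big_cons big_seq1 /=; lra.
under eq_fun do rewrite E.
rewrite /switch_mean /= /avg /= !big_cons !big_nil.
under eq_fun do rewrite big_seq1 divr1.
by rewrite u_harmonic; lra.
Qed.

(** Prepending a letter [Some x] translates the law of the position and keeps its
    entropy; prepending a switch mixes two translates, whose integrals against
    [u] have means [u g1] and [u g2] by [mean_avg_products]. *)
Lemma quenched_entropy_growth n :
  q * (u g1 - u g2) ^+ 2 / 16 * n%:R <= iter_mean switch_mean n quenched_entropy.
Proof.
set D := u g1 - u g2; set kappa := q * D ^+ 2 / 16.
have bphi m : bounded_on (of_size m) quenched_entropy.
  by apply: (@bounded_on_itv _ _ _ _ (ln 2 * m%:R)) => b <-; exact: quenched_entropy_itv.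
(* The gain sg / 2 * D - 2 * sg ^+ 2 of [seq_entropy_cat_ge] is largest here,
   and equals D ^+ 2 / 32. *)
pose sg := D / 8.
have D1 : `|D| <= 1.
  have /andP[? ?] := u_itv g1; have /andP[? ?] := u_itv g2.
  by rewrite ler_norml /D; apply/andP; split; lra.
have sg1 : `|sg| <= 2^-1.
  by move: D1; rewrite /sg !ler_norml => /andP[? ?]; apply/andP; split; lra.
elim: n => [|n IH].
  by rewrite mulr0; apply: iter_mean_ge0 => // b _; have /andP[] := quenched_entropy_itv b.
set e := iter_mean switch_mean n quenched_entropy in IH.
rewrite -[n.+1%:R]natr1 mulrDr mulr1 /=.
have ES x : iter_mean switch_mean n (fun b => quenched_entropy (Some x :: b)) = e.
  apply: iter_mean_ext => b _; rewrite /quenched_entropy /= mulseq1s seq_entropy_map//;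
    exact: mulgI.
have bN : bounded_on (of_size n) (fun b => -1 * avg (products b) (fun y => u (g2 * y)%g)).
  by apply: bounded_onZ; exact: bavg.
have bA := bounded_onD (bavg n g1) bN.
have bc := @bounded_on_cst R _ (@of_size (option G) n) (- (2 * sg ^+ 2)).
have bz := bounded_onZ (sg / 2) bA.
have EN : e + D ^+ 2 / 32 <= iter_mean switch_mean n (fun b => quenched_entropy (None :: b)).
  apply: (@le_trans _ _ (iter_mean switch_mean n (fun b => quenched_entropy b + (sg / 2 *
     (avg (products b) (fun y => u (g1 * y)%g) + (-1) * avg (products b) (fun y => u (g2 * y)%g))
     + - (2 * sg ^+ 2))))).
    rewrite (iter_meanD mIO (bphi n) (bounded_onD bz bc)) (iter_meanD mIO bz bc).
    rewrite (iter_meanZ mIO _ bA) (iter_meanD mIO (bavg n g1) bN).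
    rewrite (iter_meanZ mIO _ (bavg n g2)) (iter_mean_cst mIO) !mean_avg_products.
    by rewrite mulN1r -/D -/e /sg lerD2l le_eqVlt; apply/orP; left; apply/eqP; field.
  apply: iter_mean_le => //.
  - exact: bounded_onD (bphi n) (bounded_onD bz bc).
  - exact: bounded_on_cons.
  move=> b _; rewrite /quenched_entropy /= mulseq2s.
  have := @seq_entropy_cat_ge R _ [seq (g1 * z)%g | z <- products b] [seq (g2 * z)%g | z <- products b] u sg.
  rewrite !size_map => /(_ (size_products_gt0 b) erefl u_norm sg1).
  by rewrite !seq_entropy_map ?avg_map; [|exact: mulgI|exact: mulgI]; rewrite /comp;
    apply: le_trans; lra.
rewrite /switch_mean.
under [X in I X]eq_fun do rewrite ES.
rewrite !ES (mean_cst mI).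
have : 2 * q * (e + D ^+ 2 / 32) <= 2 * q * iter_mean switch_mean n (fun b => quenched_entropy (None :: b)).
  by rewrite ler_pM2l// mulr_gt0.
rewrite /kappa in IH *; lra.
Qed.

Lemma quenched_entropy_concentration (c : R) :
  0 < c -> u g1 != u g2 -> exists K0 : nat, forall k,
  (K0 <= k)%N -> iter_mean switch_mean k
     (fun b => (quenched_entropy b <= q * (u g1 - u g2) ^+ 2 / 16 * k%:R / 2)%R%:R) <= c.
Proof.
move=> c0 uD; apply: (subadditive_mean_concentration mIO quenched_entropy_itv quenched_entropy_subadditive) => //.
  by rewrite divr_gt0// mulr_gt0// exprn_even_gt0//= subr_eq0.
exact: quenched_entropy_growth.
Qed.

(** Functions that do not separate [g1] from [g2] do not see the coins. *)
Lemma switch_mean_base F : F g1 = F g2 -> switch_mean (fun o => F (base o)) = I F.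
Proof. by rewrite /switch_mean /= => ->; lra. Qed.

End Switch.

Section StayingGood.
Context {R : realType} {G : groupType}.
Variable good : G -> bool.

Fixpoint stays_good (x : G) (s : seq G) : bool :=
  if s is y :: s' then good x && stays_good (x * y)%g s' else good x.

Lemma stays_good_start x s : stays_good x s -> good x.
Proof. by case: s => //= y s /andP[]. Qed.

Lemma stays_good_cat x s t :
  stays_good x (s ++ t) = stays_good x s && stays_good (x * prodg s)%g t.
Proof.
elim: s x => [|y s IH] x /=.
  rewrite /prodg big_nil mulg1; case: (boolP (stays_good x t)); rewrite ?andbF ?andbT//.
  by move/stays_good_start.
by rewrite IH prodg_cons mulgA andbA.
Qed.

Lemma stays_goodP x s : reflect (forall m, (m <= size s)%N -> good (x * partial_prod s m)%g)
  (stays_good x s).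
Proof.
elim: s x => [|y s IH] x /=.
  apply: (iffP idP) => [gx [|m]//|/(_ 0%N (leqnn 0))]; rewrite partial_prod0 mulg1//.
apply: (iffP andP) => [[gx /IH h] [|m] mn|h].
- by rewrite partial_prod0 mulg1.
- by rewrite /partial_prod /= prodg_cons mulgA; exact: h.
- split; first by have := h 0%N isT; rewrite partial_prod0 mulg1.
  apply/IH => m ms; have := h m.+1 ms; by rewrite /partial_prod /= prodg_cons mulgA.
Qed.

Variable (I : (G -> R) -> R).
Hypothesis mI : is_mean I.

Let W n x : R := iter_mean I n (fun s => (stays_good x s)%:R).

Let W_itv n x : 0 <= W n x <= (good x)%:R.
Proof.
apply: iter_mean_itv => // s _; case: (boolP (stays_good x s)) => [/stays_good_start ->|_];
  by rewrite ?ler01 ?lexx ?ler0n.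
Qed.

Let W_cat a m x : W (a + m) x <= word_mean I a (fun y => (good x)%:R * W m (x * y)%g).
Proof.
rewrite /W iter_mean_cat; apply: iter_mean_le => //.
- exists 1 => s _; apply: iter_mean_norm_le => // t _.
  by case: (stays_good x _); rewrite ?normr1 ?normr0.
- exists 1 => s _; have /andP[w0 w1] := W_itv m (x * prodg s)%g.
  rewrite normrM; case: (good x);
    rewrite ?normr0 ?mul0r ?normr1 ?mul1r ?ler01// ger0_norm//.
  by apply: (le_trans w1); rewrite lern1 leq_b1.
move=> s _; rewrite -iter_meanZ//; last exact: bounded_on_bool.
apply: iter_mean_le => //; [exact: bounded_on_bool|by apply: bounded_onZ;
  exact: bounded_on_bool|].
move=> t _; rewrite stays_good_cat -natrM mulnb ler_nat.
by case: (boolP (stays_good x s)) => //= /stays_good_start ->.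
Qed.

Variables (a b N : nat) (g1 g2 : G) (q : R).
Hypotheses (aN : (a <= N)%N) (bN : (b <= N)%N).
Hypothesis q_gt0 : 0 < q.
Hypothesis q_le : forall F, bounded_on everywhere F -> (forall x, 0 <= F x) ->
  q * F g1 + q * F g2 <= mixed_mean I a b F.
Hypothesis good_switch : forall x y, good (x * g1 * y)%g = good (x * g2 * y)%g.

(** The walk of law [mixed_mean I a b] is the original walk observed at sparse
    random times, at most [N] apart, so [k] of its steps take at most [k * N]
    original ones and it stays in a set at least as easily. *)
Lemma stays_good_switch_mean k n x : (k * N <= n)%N ->
  iter_mean I n (fun s => (stays_good x s)%:R : R) <=
  iter_mean (switch_mean (mixed_mean I a b) g1 g2 q) k
    (fun c => (stays_good x (map (base g1) c))%:R).
Proof.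
have mM := mixed_mean_is_mean mI a b.
have mS := switch_mean_is_mean mM q_gt0 q_le.
set J := switch_mean _ _ _ _ in mS *.
pose V k x : R := iter_mean J k (fun c => (stays_good x (map (base g1) c))%:R).
rewrite -/(W n x) -/(V k x).
have V_itv m z : 0 <= V m z <= 1.
  by apply: iter_mean_itv => // s _; case: (stays_good _ _); rewrite ?ler01 ?lexx.
have gs x' y s : stays_good (x' * g1 * y)%g s = stays_good (x' * g2 * y)%g s.
  elim: s y => [|z s IH] y /=; first exact: good_switch.
  by rewrite good_switch -!mulgA !(mulgA x') IH.
elim: k n x => [|k IH] n x kn; first by have /andP[] := W_itv n x.
have -> : V k.+1 x = mixed_mean I a b (fun y => (good x)%:R * V k (x * y)%g).
  rewrite /V /= -(@switch_mean_base _ _ _ g1 g2 q); last first.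
    congr (_ * _); apply: iter_mean_ext => s _.
    by rewrite -[(x * g1)%g]mulg1 gs mulg1.
  congr J; apply/funext => o; rewrite -iter_meanZ//; last exact: bounded_on_bool.
  by apply: iter_mean_ext => s _; rewrite -natrM mulnb.
suff h m : (m <= N)%N -> W n x <= word_mean I m (fun y => (good x)%:R * V k (x * y)%g).
  by rewrite /mixed_mean; have := h a aN; have := h b bN; lra.
move=> mN; have mn : (m <= n)%N.
  by apply: leq_trans mN _; apply: leq_trans kn; rewrite mulSn leq_addr.
rewrite -(subnKC mn); apply: (le_trans (W_cat _ _ _)).
apply: (mean_le (word_mean_is_mean mI m)).
- exists 1 => y _; have /andP[w0 w1] := W_itv (n - m) (x * y)%g.
  rewrite normrM; case: (good x);
    rewrite ?normr0 ?mul0r ?normr1 ?mul1r ?ler01// ger0_norm//.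
  by apply: (le_trans w1); rewrite lern1 leq_b1.
- exists 1 => y _; have /andP[w0 w1] := V_itv k (x * y)%g.
  by rewrite normrM; case: (good x);
    rewrite ?normr0 ?mul0r ?normr1 ?mul1r ?ler01// ger0_norm.
- move=> y; rewrite ler_wpM2l//; apply: IH.
  by rewrite leq_subRL// (leq_trans _ kn)// mulSn leq_add2r.
Qed.

End StayingGood.

(** * The projected walk and the span *)

Section Morphisms.
Context {G K : groupType} (p : {multiplicative G -> K}).

Lemma multiplicative1 : p 1%g = 1%g.
Proof. by apply: (mulgI (p 1%g)); rewrite -gmulfM !mulg1. Qed.

Lemma multiplicativeV x : p x^-1%g = (p x)^-1%g.
Proof. by apply: (mulgI (p x)); rewrite -gmulfM !mulgV multiplicative1. Qed.

End Morphisms.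

Section Projection.
Context {R : realType} {G K : groupType}.
Variables (p : {multiplicative G -> K}) (mu : G -> R).
Variables (P : probability (path_space G) R) (Q : probability (path_space K) R).
Hypothesis mu_prob : is_prob mu.
Hypothesis P_law : walk_law mu P.
Hypothesis Q_law : walk_law (projection p mu) Q.

Let mI := step_mean_is_mean P.

(** The law [projection p mu] is defined by unordered sums over fibres; these are
    matched with the mean of [mu] through their finite partial sums. *)
Lemma step_mean_fiber k : step_mean P (fun g => (p g == k)%:R) = projection p mu k.
Proof.
have mu0 := mu_prob.1.
have bF : bounded_on everywhere (fun g => (p g == k)%:R : R) by exact: bounded_on_bool.
have sumE (L : seq G) : \sum_(g <- L) mu g * (p g == k)%:R =
    \sum_(g <- [seq g <- L | p g == k]) mu g.
  rewrite big_filter [in RHS]big_mkcond; apply: eq_bigr => g _.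
  by case: eqP; rewrite ?mulr1 ?mulr0.
have E1 : (\esum_(g in p @^-1` [set k]) (mu g)%:E <= (step_mean P (fun g => (p g == k)%:R))%:E)%E.
  apply: ge_ereal_sup => _ [A [Afin Ak] <-].
  rewrite fsbig_finite//= sumEFin lee_fin.
  apply: le_trans (sum_le_step_mean P_law (finmap.fset_uniq (fset_set A)) bF _); last by [].
  rewrite big_seq [leRHS]big_seq; apply: ler_sum => g.
  by rewrite in_fset_set// inE => /Ak /= ->; rewrite eqxx mulr1.
have fin : (\esum_(g in p @^-1` [set k]) (mu g)%:E)%E \is a fin_num.
  rewrite ge0_fin_numE; first exact: le_lt_trans E1 (ltry _).
  by apply: esum_ge0 => g _; rewrite lee_fin.
apply/eqP; rewrite eq_le; apply/andP; split; last by rewrite -lee_fin fineK.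
apply: (step_mean_le P_law mu_prob bF) => L uL.
rewrite -lee_fin fineK// sumE; apply: esum_ge.
exists [set` [seq g <- L | p g == k]].
  split; first exact: finite_seq.
  by move=> g /=; rewrite mem_filter => /andP[/eqP].
by rewrite -sumEFin -fsbig_seq// filter_uniq.
Qed.

Lemma iter_mean_project n (x : G) (y : nat -> K) :
  iter_mean (step_mean P) n
    (fun s => (`[< forall m, (m <= n)%N -> p (x * partial_prod s m)%g = y m >])%:R) =
  (y 0%N == p x)%:R * \prod_(m < n) projection p mu ((y m)^-1 * y m.+1)%g.
Proof.
elim: n x y => [|n IH] x y.
  rewrite /= big_ord0 mulr1; congr (nat_of_bool _)%:R.
  apply/asboolP/eqP => [/(_ 0%N isT)|e [|m]//]; first by rewrite partial_prod0 mulg1.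
  by rewrite partial_prod0 mulg1.
have step g s : `[< forall m, (m <= n.+1)%N -> p (x * partial_prod (g :: s) m)%g = y m >] =
   (y 0%N == p x) && `[< forall m, (m <= n)%N -> p (x * g * partial_prod s m)%g = y m.+1 >].
  apply/asboolP/andP => [h|[/eqP y0 /asboolP h] [|m] mn].
  - split; first by rewrite -(h 0%N isT) partial_prod0 mulg1.
    by apply/asboolP => m mn; rewrite -(h m.+1 mn) /partial_prod /= prodg_cons mulgA.
  - by rewrite partial_prod0 mulg1.
  - by rewrite -(h m mn) /partial_prod /= prodg_cons mulgA.
rewrite big_ord_recl /=.
set pr := \prod_(m < n) _.
rewrite (_ : (fun g => _) = (fun g => ((y 0%N == p x)%:R * pr) * (p g == (y 0%N)^-1 * y 1%N)%g%:R)).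
  rewrite (meanZ mI); last exact: bounded_on_bool.
  by rewrite step_mean_fiber -!mulrA (mulrC pr).
apply/funext => g.
under [X in iter_mean _ _ X]eq_fun do rewrite step -mulnb natrM.
rewrite (iter_meanZ mI); last exact: bounded_on_bool.
rewrite IH; have [y0|] := eqVneq (y 0%N) (p x); last by rewrite !mul0r.
rewrite !mul1r mulrC; congr (_ * (nat_of_bool _)%:R).
by rewrite gmulfM eq_sym y0; apply/eqP/eqP => [<-|->]; rewrite ?mulKg ?mulVKg.
Qed.

Definition project (x : path_space G) : path_space K := fun n => p (x n).

Lemma measurable_project : measurable_fun setT project.
Proof.
by apply: measurable_path_fun => m B; exact: (measurable_coord m [set z | B (p z)]).
Qed.

Hypothesis Kcount : countable [set: K].

(** The projection of the walk on G is a walk of law [projection p mu] on K, and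
    this determines its law. *)
Lemma project_law A : measurable A -> Q A = P (project @^-1` A).
Proof.
have [m mE] := image_measure P measurable_project.
rewrite -mE; apply: path_measure_unique => //.
- rewrite mE; rewrite [LHS](@probability_setT _ _ _ Q) -(@probability_setT _ _ _ P).
  by congr (P _).
- by rewrite (le_lt_trans (probability_le1 Q _))// ltry.
move=> n y; rewrite mE; apply: etrans (P_cyl Q_law n y) _.
have mc : measurable (project @^-1` (cyl n y)).
  by rewrite -[X in measurable X]setTI; apply: measurable_project => //;
    exact: measurable_cyl.
have nc : adapted n (project @^-1` (cyl n y)).
  by move=> x x' xx' h k kn; rewrite /project -xx'//; exact: h.
apply: etrans (esym (P_adapted P_law mu_prob mc nc)).
congr (_%:E); have := iter_mean_project n 1%g y.
rewrite multiplicative1.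
move=> <-; apply: iter_mean_ext => s _; congr (nat_of_bool _)%:R.
by apply/asboolP/asboolP => h k kn; have := h k kn; rewrite ?mul1g.
Qed.

Variables (S : set K) (f : nat -> R).
Hypothesis f_incr : {homo f : m n / (m <= n)%N >-> m <= n}.
Hypothesis f_pos : exists n, 0 < f n.
Hypothesis Q_cautious : cautious S f Q.

Lemma wlen1 : wlen S 1%g = 0%N.
Proof.
rewrite /wlen; set E := [set n | _].
have E0 : E 0%N by split=> //; exists [::]; split=> //; rewrite big_nil.
by have [_ h] := getPex (ex_intro _ _ E0); apply/eqP; rewrite -leqn0; apply: h; case: E0.
Qed.

(** Cautiousness as it is used: for infinitely many n, with probability bounded
    below, all of the first n + 1 positions project into a ball of radius
    delta * f n. The starting point is included because f is eventually
    positive. *)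
Lemma cautious_stays_good (delta : R) : 0 < delta -> exists2 c : R, 0 < c &
  forall N0 : nat, exists2 n, (N0 <= n)%N &
  c <= iter_mean (step_mean P) n
    (fun s => (stays_good (fun g => (wlen S (p g))%:R <= delta * f n)%R 1%g s)%:R).
Proof.
move=> d0; have := Q_cautious d0; rewrite /limn_esup /limf_esup.
set U := fun n : nat => Q _; set E := ereal_inf _ => E0.
have [c c0 cE] : exists2 c : R, 0 < c & (c%:E < E)%E.
  case: E E0 => [e|_|//]; last by exists 1 => //; exact: ltry.
  by rewrite lte_fin => e0; exists (e / 2); rewrite ?lte_fin; lra.
exists c => // N0; have [n1 fn1] := f_pos.
pose N1 := maxn N0 n1.
have : (c%:E < ereal_sup (U @` [set n | (N1 <= n)%N]))%E.
  apply: (lt_le_trans cE); apply: ereal_inf_lbound.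
  by exists [set n | (N1 <= n)%N] => //; exists N1.
move=> /ereal_sup_gt[_ [n /= N1n <-]] cU.
move: N1n; rewrite geq_max => /andP[N0n n1n]; exists n => //.
have fn0 : 0 < f n by apply: (lt_le_trans fn1); exact: f_incr.
rewrite -lee_fin; apply: (le_trans (ltW cU)); rewrite /U.
set A := [set x | _].
pose B := [set x : path_space K | forall m, (m <= n)%N -> x 0%N = 1%g -> ((wlen S (x m))%:R <= delta * f n)%R].
have nA : adapted n A.
  move=> x x' xx' Ax; rewrite /A /= (_ : (\max_(1 <= m < n.+1) wlen S (x' m))%N =
    (\max_(1 <= m < n.+1) wlen S (x m))%N)//.
  rewrite big_nat_cond [RHS]big_nat_cond; apply: eq_bigr => m /andP[/andP[_ mn] _].
  by rewrite xx'.
have nB : adapted n B.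
  by move=> x x' xx' Bx m mn; rewrite -!xx'//; exact: Bx.
have mB := measurable_adapted Kcount nB.
apply: (@le_trans _ _ (Q B)).
  rewrite le_measure ?inE//; first exact: measurable_adapted nA.
  move=> x; rewrite /A /= ltr_pdivrMr// => h [|m] mn x0.
    by rewrite x0 wlen1 mulr_ge0// ltW.
  apply: ltW; apply: le_lt_trans h; rewrite ler_nat.
  by apply: (@leq_bigmax_seq _ (index_iota 1 n.+1) xpredT (fun m => wlen S (x m))) => //;
    rewrite mem_index_iota.
have mpB : measurable (project @^-1` B).
  by rewrite -[X in measurable X]setTI; exact: measurable_project.
have npB : adapted n (project @^-1` B).
  by move=> x x' xx' Bx m mn; rewrite /project -!xx'//; exact: Bx.
rewrite project_law//; rewrite [X in (X <= _)%E](P_adapted P_law mu_prob mpB npB).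
rewrite lee_fin; apply: (iter_mean_le mI); [exact: bounded_on_bool|exact: bounded_on_bool|].
move=> s sn; rewrite ler_nat; case: asboolP => // Bs.
rewrite (_ : stays_good _ _ _)//; apply/stays_goodP => m; rewrite sn mul1g => mn.
by apply: Bs => //; rewrite /project partial_prod0; exact: multiplicative1.
Qed.

End Projection.

Section SpanBound.
Context {R : realType} {H G K : groupType}.
Variables (i : {multiplicative H -> G}) (p : {multiplicative G -> K}).
Hypothesis exact_HGK : short_exact i p.
Variables (S : set K) (h : H) (r : R) (g1 : G).

Let g2 := (i h * g1)%g.

Let good (x : G) : bool := (wlen S (p x))%:R <= r.

(** Each switch that picks [g2 = i h * g1] at the current position [x] inserts a
    factor [i h] after [x], and moving it to the left conjugates it by [x]. The
    element of K that acts is the image of [x], which is the same for all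
    outcomes of the coins. *)
Lemma products_in_span (x : G) (b : seq (option G)) : stays_good good x (map (base g1) b) ->
  forall z, z \in products g1 g2 b -> exists t : H,
    span_set i p S [set h] r (size b) t /\
    (x * z)%g = (i t * (x * prodg (map (base g1) b)))%g.
Proof.
have [iI iK pS] := exact_HGK.
elim: b x => [|o b IH] x /= gx z.
  rewrite inE => /eqP ->; exists 1%g; split.
    by exists [::]; split=> //; rewrite big_nil.
  by rewrite /prodg big_nil multiplicative1 mul1g.
have [gx0 gxb] : good x /\ stays_good good (x * base g1 o)%g (map (base g1) b) by apply/andP.
move=> /allpairsP[[y w] /= [yo wb ->]].
have [t [[s [sz sS tE]] wE]] := IH _ gxb w wb.
have [yb|[on yg2]] : y = base g1 o \/ o = None /\ y = g2.
  case: (o) yo => [a|] /=; first by rewrite inE => /eqP ->; left.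
  by rewrite !inE => /orP[] /eqP ->; [left|right].
  exists t; split; first by exists s; split=> //; exact: leq_trans sz _.
  by rewrite yb mulgA wE prodg_cons !mulgA.
have [h' h'E] : exists h', i h' = (x * i h * x^-1)%g.
  have : range i (x * i h * x^-1)%g; last by case=> h' _ <-; exists h'.
  rewrite iK /= !gmulfM multiplicativeV.
  have -> : p (i h) = 1%g by have : range i (i h) by []; rewrite iK.
  by rewrite mulg1 mulgV.
exists (h' * t)%g; split.
  exists (h' :: s); split=> //; last by rewrite big_cons tE.
  move=> h0; rewrite inE => /orP[/eqP ->|]; last exact: sS.
  by exists (p x), h; split=> //; exists x.
rewrite on /= in wE *.
rewrite yg2 /g2 gmulfM h'E prodg_cons.
transitivity ((x * i h * x^-1) * (x * g1 * w))%g; first by rewrite !mulgA mulgVK.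
by rewrite wE !mulgA.
Qed.

End SpanBound.
(** * Elements of small span preserve harmonic functions *)

Section SpanInvariance.
Context {R : realType} {H G K : groupType}.
Variables (i : {multiplicative H -> G}) (p : {multiplicative G -> K}).
Hypothesis exact_HGK : short_exact i p.
Variables (S : set K) (f : nat -> R) (mu : G -> R) (P : probability (path_space G) R).
Hypothesis mu_prob : is_prob mu.
Hypothesis mu_nondeg : non_degenerate mu.
Hypothesis P_law : walk_law mu P.

Let mI := step_mean_is_mean P.

(** Positions reached from the same letters differ by the element of H found by
    [products_in_span], so there are at most as many as elements in the span. *)
Lemma card_products_le (h : H) (r M : R) n (g1 : G) (b : seq (option G)) :
  stays_good (fun x => (wlen S (p x))%:R <= r)%R 1%g (map (base g1) b) -> (size b <= n)%N ->
  (Span i p S [set h] r n <= M%:E)%E ->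
  (size (undup (products g1 (i h * g1)%g b)))%:R <= M.
Proof.
move=> gb bn; set A := span_set i p S [set h] r n.
have inA z : z \in products g1 (i h * g1)%g b -> exists t : H,
    A t /\ z = (i t * prodg (map (base g1) b))%g.
  move=> /(products_in_span exact_HGK gb)[t [[s [sz sS tE]] zE]].
  exists t; split; first by exists s; split=> //; exact: leq_trans sz _.
  by move: zE; rewrite !mul1g.
rewrite /Span -/A /counting; case: asboolP => [Afin|_]; last by rewrite leye_eq.
rewrite lee_fin; apply: le_trans; rewrite ler_nat.
have /choice[c cP] : forall z, exists t : H, z \in products g1 (i h * g1)%g b ->
    A t /\ z = (i t * prodg (map (base g1) b))%g.
  by move=> z; have [/inA[t tP]|zb] := boolP (z \in products g1 (i h * g1)%g b);
    [exists t|exists 1%g].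
rewrite -(size_map c); apply: uniq_leq_size.
  rewrite map_inj_in_uniq ?undup_uniq// => x y;
    rewrite !mem_undup => /cP[_ xE] /cP[_ yE] cxy.
  by rewrite xE yE cxy.
move=> t /mapP[z]; rewrite mem_undup => /cP[Ac _] ->.
by rewrite in_fset_set// inE.
Qed.

Hypothesis cautious_walk : forall delta : R, 0 < delta -> exists2 c : R, 0 < c &
  forall N0 : nat, exists2 n, (N0 <= n)%N &
  c <= iter_mean (step_mean P) n
    (fun s => (stays_good (fun g => (wlen S (p g))%:R <= delta * f n)%R 1%g s)%:R).

Variables (u : G -> R) (h : H).
Hypothesis u_itv : forall x, 0 <= u x <= 1.
Hypothesis u_harmonic : forall x, step_mean P (fun g => u (x * g)%g) = u x.
Hypothesis h_span : small_span i p S f [set h].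

Lemma step_mean_ge_atom F g : bounded_on everywhere F -> (forall x, 0 <= F x) ->
  mu g * F g <= step_mean P F.
Proof.
move=> bF F0; have := @sum_le_step_mean _ _ _ _ P_law [:: g] F isT bF F0.
by rewrite big_seq1.
Qed.

Lemma harmonic_span_invariant g : u (i h * g)%g = u g.
Proof.
apply: contrapT => /eqP uD.
have mu0 := mu_prob.1.
have mass_gt0 (w : seq G) : (forall x, x \in w -> mu x != 0) -> 0 < \prod_(x <- w) mu x.
  move=> wmu; rewrite big_seq prodr_gt0// => x xw.
  by rewrite lt_neqAle eq_sym wmu//=; exact: mu0.
set g2 := (i h * g)%g.
have [w1 [_ /mass_gt0 m1 w1E]] := mu_nondeg g.
have [w2 [_ /mass_gt0 m2 w2E]] := mu_nondeg g2.
set q1 := \prod_(x <- w1) mu x in m1; set q2 := \prod_(x <- w2) mu x in m2.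
(* The factor 1 / 2 is the weight of each convolution power in the mixture. *)
pose q := Num.min q1 q2 / 2.
have q0 : 0 < q by rewrite divr_gt0// lt_min m1.
pose a := size w1; pose b := size w2.
pose I := mixed_mean (step_mean P) a b.
have mM : is_mean I by exact: mixed_mean_is_mean.
have q_le F : bounded_on everywhere F -> (forall x, 0 <= F x) -> q * F g + q * F g2 <= I F.
  move=> bF F0.
  have := word_mean_ge_atom mI w1 mu0 step_mean_ge_atom bF F0.
  have := word_mean_ge_atom mI w2 mu0 step_mean_ge_atom bF F0.
  rewrite -/(a) -/(b) /prodg -w1E -w2E -/q1 -/q2 /I /mixed_mean.
  have : Num.min q1 q2 * F g <= q1 * F g by rewrite ler_wpM2r// ge_min lexx.
  have : Num.min q1 q2 * F g2 <= q2 * F g2 by rewrite ler_wpM2r// ge_min lexx orbT.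
  by rewrite /q; move=> ? ? ? ?; lra.
have u_harm x : I (fun z => u (x * z)%g) = u x.
  by rewrite /I /mixed_mean !word_mean_harmonic//; lra.
have mJ := switch_mean_is_mean mM q0 q_le.
set J := switch_mean I g g2 q in mJ.
pose kappa := q * (u g - u g2) ^+ 2 / 16.
have kappa0 : 0 < kappa.
  by rewrite divr_gt0// mulr_gt0// exprn_even_gt0//= subr_eq0 eq_sym.
(* At most [N] original steps make one step of the mixture. The choice of [eps]
   makes eps * (k + 1) * N equal to kappa / 4 * (k + 1), which leaves kappa / 4 * k
   to absorb the constant [C1]. *)
pose N := (maxn a b).+1.
pose eps := kappa / (4 * N%:R).
have N0 : 0 < N%:R :> R by rewrite ltr0n.
have eps0 : 0 < eps by rewrite divr_gt0// mulr_gt0.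
have [delta [C [delta0 C0 spanC]]] := h_span eps0.
have [c c0 cautious] := cautious_walk delta0.
have c20 : 0 < c / 2 by rewrite divr_gt0.
have uD' : u g != u g2 by rewrite eq_sym.
have [K0 hK0] := quenched_entropy_concentration mM q0 q_le u_itv u_harm c20 uD'.
pose C1 := ln C + kappa / 4.
have [K1 hK1] : exists K1 : nat, C1 / (kappa / 4) < K1%:R.
  exists (Num.bound `|C1 / (kappa / 4)|);
    rewrite (le_lt_trans (ler_norm _))// archi_boundP//.
have [n nK cn] := cautious (maxn K0 K1 * N)%N.
set k := (n %/ N)%N.
have kK : (maxn K0 K1 <= k)%N by rewrite leq_divRL.
move: kK; rewrite geq_max => /andP[kK0 kK1].
have kn : (k * N <= n)%N by exact: leq_divM.
have aN : (a <= N)%N by rewrite /N; apply: leqW; exact: leq_maxl.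
have bN : (b <= N)%N by rewrite /N; apply: leqW; exact: leq_maxr.
set good := fun g : G => _ in cn.
have good_switch x y : good (x * g * y)%g = good (x * g2 * y)%g.
  rewrite /good /g2 !gmulfM; congr ((wlen S (_ * _ * _)%g)%:R <= _).
  have -> : p (i h) = 1%g.
    have [_ iK _] := exact_HGK.
    by have : range i (i h) by []; rewrite iK.
  by rewrite mul1g.
have := stays_good_switch_mean mI aN bN q0 q_le good_switch 1%g kn.
rewrite -/I -/J => cJ.
have hJ : iter_mean J k (fun c0 => (stays_good good 1%g (map (base g) c0))%:R) <=
    iter_mean J k (fun b => ((quenched_entropy g g2 b : R) <= kappa * k%:R / 2)%R%:R).
  apply: (iter_mean_le mJ); [exact: bounded_on_bool|exact: bounded_on_bool|].
  move=> s sk; rewrite ler_nat.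
  case: (boolP (stays_good good 1%g (map (base g) s))) => // gs.
  rewrite (_ : (quenched_entropy g g2 s : R) <= _)//.
  have sn : (size s <= n)%N by rewrite sk leq_div.
  have hM := card_products_le gs sn (spanC n).
  have s0 := size_products_gt0 g g2 s.
  apply: (le_trans (seq_entropy_le_ln_card s0 (leqnn _))).
  have e1 : 0 < 1 + eps by rewrite addr_gt0.
  have u0 : 0 < (size (undup (products g g2 s)))%:R :> R.
    rewrite ltr0n; have [x xs] : exists x, x \in products g g2 s.
      by case: (products g g2 s) s0 => // x s' _; exists x; rewrite mem_head.
    by case: (undup _) (mem_undup (products g g2 s) x) => //; rewrite xs.
  apply: (@le_trans _ _ (ln (C * (1 + eps) ^+ n))).
    by rewrite ler_ln ?posrE ?mulr_gt0 ?exprn_gt0.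
  rewrite lnM ?posrE ?exprn_gt0// lnXn// -[ln (1 + eps) *+ n]mulr_natr.
  have le1 : ln (1 + eps) * n%:R <= eps * n%:R.
    by rewrite ler_wpM2r// le_ln1Dx// (lt_trans _ eps0)// ltrN10.
  have nk : n%:R <= k.+1%:R * N%:R :> R.
    rewrite -natrM ler_nat ltnW// mulSn addnC {1}(divn_eq n N) ltn_add2l.
    by rewrite ltn_pmod.
  have le2 : eps * n%:R <= eps * (k.+1%:R * N%:R) by rewrite ler_pM2l.
  have E : eps * (k.+1%:R * N%:R) = kappa / 4 * k%:R + kappa / 4.
    by rewrite /eps -[k.+1%:R]natr1; field; rewrite gt_eqF.
  have hC1 : C1 <= kappa / 4 * k%:R.
    have k40 : 0 < kappa / 4 by rewrite divr_gt0.
    rewrite [leRHS]mulrC -ler_pdivrMr//; apply: (le_trans (ltW hK1)).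
    by rewrite ler_nat.
  by rewrite /C1 in hC1; lra.
have := hK0 k kK0; rewrite -/J -/kappa; lra.
Qed.

End SpanInvariance.
(** * Boundary events and their harmonic functions *)

Section Countability.
Context {R : realType} {G : groupType}.
Variables (mu : G -> R) (P : probability (path_space G) R).
Hypothesis mu_prob : is_prob mu.
Hypothesis P_law : walk_law mu P.

Lemma countable_support : countable [set g | mu g != 0].
Proof.
have tight n : exists L : seq G, uniq L /\ 1 - n.+1%:R^-1 < \sum_(g <- L) mu g.
  have n0 : 0 < n.+1%:R^-1 :> R by rewrite invr_gt0.
  by have [L uL hL] := mass_tight mu_prob n0; exists L.
have /choice[L hL] := tight.
apply: (@sub_countable _ _ _ (\bigcup_n [set` L n])); last first.
  by apply: bigcup_countable => // n _; apply: finite_set_countable; exact: finite_seq.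
apply: subset_card_le => g /= g0; apply: contrapT => nL.
have mg : 0 < mu g by rewrite lt_neqAle eq_sym g0 mu_prob.1.
have [n hn] : exists n : nat, n.+1%:R^-1 < mu g.
  exists (Num.bound (mu g)^-1); rewrite -[ltRHS]invrK ltf_pV2 ?posrE ?invr_gt0//.
  apply: (lt_trans (archi_boundP _)); first by rewrite invr_ge0 ltW.
  by rewrite ltr_nat.
have [uL sL] := hL n.
have ugL : uniq (g :: L n).
  by rewrite /= uL andbT; apply/negP => gL; apply: nL; exists n.
have mI := step_mean_is_mean P.
have := @sum_le_step_mean _ _ _ _ P_law _ (fun=> 1) ugL (bounded_on_cst _ 1) (fun=> ler01).
rewrite (mean1 mI) big_cons mulr1.
have -> : \sum_(x <- L n) mu x * 1 = \sum_(x <- L n) mu x by apply: eq_bigr => x _;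
  rewrite mulr1.
by move: sL hn; set t := _^-1 => sL hn h; lra.
Qed.

(** Every element is the value of some word in the countable support. *)
Lemma countable_group : non_degenerate mu -> countable [set: G].
Proof.
move=> nondeg; have /countable_injP[c cI] := countable_support.
have /choice[w wP] : forall g, exists s : seq G,
    (forall x, x \in s -> mu x != 0) /\ g = (\prod_(x <- s) x)%g.
  by move=> g; have [s [_ sm sg]] := nondeg g; exists s.
apply/countable_inj; exists (fun g => pickle (map c (w g))) => g g' /(pcan_inj pickleK) e.
rewrite (wP g).2 (wP g').2; congr (\big[_/_]_(x <- _) _).
have := (wP g).1; have := (wP g').1.
elim: (w g) (w g') e => [|x s IH] [|x' s'] //= [cx cs] h' h.
congr cons; last first.
  by apply: IH => // z zs; [apply: h'|apply: h]; rewrite inE zs orbT.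
apply: cI => //; rewrite in_setE /=; [apply: h|apply: h']; exact: mem_head.
Qed.

End Countability.

Lemma subset_counting (R : realType) (T : choiceType) (A B : set T) : A `<=` B ->
  (@counting T R A <= @counting T R B)%E.
Proof.
move=> AB; rewrite /counting; case: (asboolP (finite_set B)) => [Bf|_]; last exact: leey.
have Af := sub_finite_set AB Bf; rewrite asboolT// lee_fin ler_nat.
apply: uniq_leq_size; first exact: finmap.fset_uniq.
by move=> x; rewrite !in_fset_set// !inE; exact: AB.
Qed.

Section BoundaryEvents.
Context {R : realType} {G : groupType}.
Variables (mu : G -> R) (P : probability (path_space G) R).
Hypothesis mu_prob : is_prob mu.
Hypothesis P_law : walk_law mu P.
Hypothesis Gcount : countable [set: G].

Lemma translate_image g (A : set (path_space G)) :
  translate g @` A = translate g^-1%g @^-1` A.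
Proof.
apply/seteqP; split => x /=.
  move=> [y Ay <-]; rewrite (_ : translate _ _ = y)//.
  by apply/funext => n; rewrite /translate mulKg.
move=> Ax; exists (translate g^-1%g x) => //.
by apply/funext => n; rewrite /translate mulVKg.
Qed.

(** With equal harmonic functions, [A] and [B] have the same mass on each
    cylinder, by [P_cyl_boundary], and therefore inside each measurable set, in
    particular inside the complements of [A] and of [B]. *)
Lemma boundary_fun_determines (A B : set (path_space G)) :
  boundary_sets A -> boundary_sets B -> boundary_fun P A =1 boundary_fun P B ->
  P (A `+` B) = 0%E.
Proof.
move=> bA bB uAB; have [mA _] := bA; have [mB _] := bB.
have PE X : boundary_sets X -> P X = (boundary_fun P X 1%g)%:E.
  by move=> bX; rewrite boundary_fun1 ?fineK ?fin_num_measure//; exact: bX.1.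
have key X : measurable X -> P (X `&` A) = P (X `&` B).
  move=> mX; apply: (@path_measure_unique _ Gcount _ (mrestr P mA) (mrestr P mB) _ _ _ X mX).
  - change (P (setT `&` A) = P (setT `&` B)).
    by rewrite !setTI; rewrite (PE A)// (PE B)// uAB.
  - change (P (setT `&` A) < +oo)%E.
    by rewrite setTI (PE A)// ltry.
  - move=> n y; change (P (cyl n y `&` A) = P (cyl n y `&` B)).
    by rewrite !(P_cyl_boundary P_law Gcount)// uAB.
rewrite /setY measureU//; first last.
- by apply/seteqP; split => x // [[_ nB] [Bx]].
- exact: measurableD.
- exact: measurableD.
rewrite !setDE (setIC A) (setIC B) [X in (X + _)%E](key _ (measurableC mB)).
by rewrite -[X in (_ + X)%E](key _ (measurableC mA)) !setICl !measure0 adde0.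
Qed.

Lemma invariant_boundary_fun_acts_trivially (A : set (path_space G)) g :
  boundary_sets A -> (forall x, boundary_fun P A (g * x)%g = boundary_fun P A x) ->
  P (A `+` (translate g @` A)) = 0%E.
Proof.
move=> bA ug; rewrite translate_image; apply: boundary_fun_determines => //.
  exact: boundary_translate.
by move=> x; rewrite boundary_fun_translate -[in LHS](mulVKg g x) ug.
Qed.

Definition approximable (X : set (path_space G)) := measurable X /\
  forall eps : R, 0 < eps -> exists n C, adapted n C /\ (P (X `+` C) <= eps%:E)%E.

Lemma adapted_widen n m (C : set (path_space G)) : (n <= m)%N -> adapted n C -> adapted m C.
Proof. by move=> nm nC x x' xx'; apply: nC => k kn; apply: xx'; exact: leq_trans nm. Qed.

Lemma approximable_setU X Y : approximable X -> approximable Y -> approximable (X `|` Y).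
Proof.
move=> [mX aX] [mY aY]; split; first exact: measurableU.
move=> eps e0; have e20 : 0 < eps / 2 by rewrite divr_gt0.
have [n [C [nC hC]]] := aX _ e20; have [m [D [mD hD]]] := aY _ e20.
exists (maxn n m), (C `|` D); split.
  have nC' := adapted_widen (leq_maxl n m) nC; have mD' := adapted_widen (leq_maxr n m) mD.
  by move=> x x' xx' [/(nC' _ _ xx')|/(mD' _ _ xx')]; [left|right].
have mC := measurable_adapted Gcount nC; have mD1 := measurable_adapted Gcount mD.
have m1 : measurable (X `+` C) by apply: measurableU; exact: measurableD.
have m2 : measurable (Y `+` D) by apply: measurableU; exact: measurableD.
apply: (@le_trans _ _ (P (X `+` C) + P (Y `+` D))%E); last first.
  by rewrite [eps]splitr EFinD leeD.
apply: le_trans (measureU2 _ _ _) => //.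
rewrite le_measure ?inE//; first by apply: measurableU; apply: measurableD;
  exact: measurableU.
  exact: measurableU.
rewrite /setY => x /= [[[Xx|Yx] nCD]|[[Cx|Dx] nXY]].
- by left; left; split=> // h; apply: nCD; left.
- by right; left; split=> // h; apply: nCD; right.
- by left; right; split=> // h; apply: nXY; left.
- by right; right; split=> // h; apply: nXY; right.
Qed.

Lemma adapted_approximable n C : adapted n C -> approximable C.
Proof.
move=> nC; split; first exact: measurable_adapted nC.
by move=> eps e0; exists n, C; split=> //; rewrite setYK measure0 lee_fin ltW.
Qed.

Lemma approximable_bigcup (F : nat -> set (path_space G)) :
  (forall n, approximable (F n)) -> approximable (\bigcup_k F k).
Proof.
move=> aF; have mF n : measurable (F n) := (aF n).1.
split; first exact: bigcupT_measurable.
move=> eps e0; have e20 : 0 < eps / 2 by rewrite divr_gt0.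
set X := \bigcup_k F k; pose U n := \big[setU/set0]_(k < n) F k.
have aU n : approximable (U n).
  elim: n => [|n IH]; first by rewrite /U big_ord0;
    apply: (adapted_approximable (n := 0%N)) => x x' _ [].
  by rewrite /U big_ord_recr /=; exact: approximable_setU.
have mU n := (aU n).1.
have mX : measurable X by exact: bigcupT_measurable.
have UX n : U n `<=` X by exact: bigsetU_bigcup.
have [n hn] : exists n, (P (X `\` U n) <= (eps / 2)%:E)%E.
  have : P (U n) @[n --> \oo] --> P (\bigcup_n U n).
    apply: nondecreasing_cvg_mu => //; first exact: bigcupT_measurable.
    by move=> a b ab; apply/subsetPset; exact: subset_bigsetU.
  have -> : \bigcup_n U n = X.
    apply/seteqP; split => [x [k _ /UX]//|x [k _ Fkx]].
    by exists k.+1 => //; rewrite /U big_ord_recr /=; right.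
  have [px PX] : exists px, P X = px%:E by exists (fine (P X));
    rewrite fineK// fin_num_measure.
  rewrite PX => /fine_cvgP[_ /cvgr_gt /(_ (px - eps / 2))].
  have lt_px : px - eps / 2 < px by lra.
  move=> /(_ lt_px) [n _ /(_ n (leqnn n)) /= hn]; exists n.
  have PXU : P X = (P (U n) + P (X `\` U n))%E.
    rewrite -measureU//; last by apply/seteqP; split => // x [a [_ na]].
      by rewrite setDUK.
    exact: measurableD.
  have [pu PU] : exists pu, P (U n) = pu%:E by exists (fine (P (U n)));
    rewrite fineK// fin_num_measure.
  have [pd PD] : exists pd, P (X `\` U n) = pd%:E.
    by exists (fine (P (X `\` U n))); rewrite fineK// fin_num_measure//; exact: measurableD.
  move: PXU hn; rewrite PX PU PD lee_fin /= => -[->]; lra.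
have [m [C [mC hC]]] := (aU n).2 _ e20.
exists m, C; split=> //.
have mC' := measurable_adapted Gcount mC.
have m1 : measurable (X `\` U n) by exact: measurableD.
have m2 : measurable (U n `+` C) by apply: measurableU; exact: measurableD.
apply: (@le_trans _ _ (P (X `\` U n) + P (U n `+` C))%E); last first.
  by rewrite [eps]splitr EFinD leeD.
apply: le_trans (measureU2 _ _ _) => //.
rewrite le_measure ?inE//; first by apply: measurableU; exact: measurableD.
  exact: measurableU.
rewrite /setY => x /= [[Xx nCx]|[Cx nXx]].
  by have [Ux|nUx] := pselect (U n x); [right; left|left].
by right; right; split=> // /UX.
Qed.

(** Approximable sets form a sigma-algebra containing the cylinders. *)
Lemma measurable_approximable X : measurable X -> approximable X.
Proof.
move: X; apply: smallest_sub; last first.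
  by move=> _ [n [B ->]]; apply: (adapted_approximable (n := n)) => x x' xx' /=;
    rewrite xx'.
split.
- by apply: (adapted_approximable (n := 0%N)) => x x' _ [].
- move=> X [mX aX]; rewrite setTD; split; first exact: measurableC.
  move=> eps e0; have [n [C [nC hC]]] := aX _ e0.
  exists n, (~` C); split; first by move=> x x' xx' Cx Cx'; apply: Cx;
    apply: nC Cx' => k kn; rewrite xx'.
  rewrite (_ : ~` X `+` ~` C = X `+` C)//.
  rewrite /setY; apply/seteqP; split => x /=.
    by move=> [[nX /contrapT]|[nC' /contrapT]]; [right|left].
  by move=> [[Xx nCx]|[Cx nXx]]; [right|left]; split=> // h; exact: h.
- exact: approximable_bigcup.
Qed.

End BoundaryEvents.
(** * A zero-one criterion for boundary events *)

Section Recurrence.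
Context {R : realType} {G : groupType}.
Variables (mu : G -> R) (P : probability (path_space G) R).
Hypothesis P_law : walk_law mu P.
Hypothesis Gcount : countable [set: G].
Variable A : set (path_space G).
Hypothesis bA : boundary_sets A.

Let u := boundary_fun P A.
Let mA := bA.1.

(** On a cylinder in [D] the conditional probability of [A] is the value of its
    harmonic function at time [n]; sum over the cylinders that make up [D]. *)
Lemma P_boundary_ge_half_adapted n (D : set (path_space G)) : adapted n D ->
  (forall x, D x -> 2^-1 <= u (x n)) -> (2^-1%:E * P D <= P (D `&` A))%E.
Proof.
move=> nD uD; have mD := measurable_adapted Gcount nD.
have [F [tF UF FE]] := path_prefix_decomposition Gcount n.
have mF k : measurable (F k).
  by have [->//|[y ->]] := FE k; exact: measurable_cyl.
have split_P X : measurable X -> P X = (\sum_(k <oo) P (X `&` F k))%E.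
  move=> mX; rewrite -[in LHS](setIT X) -UF setI_bigcupr measure_semi_bigcup//.
  - by move=> k; exact: measurableI.
  - exact: trivIset_setIl.
  - by apply: bigcupT_measurable => k; exact: measurableI.
rewrite (split_P D)// (split_P (D `&` A)); last exact: measurableI.
rewrite -nneseriesZl//.
apply: lee_nneseries => [k _ _|k _]; first by rewrite mule_ge0.
have [->|[y Fy]] := FE k; first by rewrite !setI0 measure0 mule0.
have [Dy|nDy] := pselect (D (y : path_space G)).
  have DF : D `&` F k = cyl n y.
    rewrite Fy; apply/seteqP; split => [x []//|x xy]; split=> //.
    by apply: nD Dy => m mn; rewrite xy.
  have DAF : D `&` A `&` F k = cyl n y `&` A by rewrite -DF setIAC.
  rewrite DF DAF (P_cyl_boundary P_law Gcount bA) muleC lee_wpmul2l//.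
  by rewrite lee_fin uD.
rewrite (_ : D `&` F k = set0) ?measure0 ?mule0//.
apply/seteqP; split => // x [Dx]; rewrite Fy => xy; apply: nDy.
by apply: nD Dx => m mn; rewrite xy.
Qed.

Definition infinitely_often (B : set G) : set (path_space G) :=
  [set x | forall N, exists2 n, (N <= n)%N & B (x n)].

Lemma measurable_infinitely_often B : measurable (infinitely_often B).
Proof.
rewrite (_ : infinitely_often B =
    \bigcap_N \bigcup_(n in [set n | (N <= n)%N]) [set x | B (x n)]).
  apply: bigcapT_measurable => N; apply: bigcup_measurable => n _.
  exact: measurable_coord.
by apply/seteqP; split => x h N => [_|]; have [] := h N => // n Nn Bn; exists n.
Qed.

Hypothesis u_recurrent : P (infinitely_often [set g | 2^-1 <= u g]) = 1%E.

(** Split [C] according to the first time from [N] on at which [u] is at least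
    1/2, which exists almost surely. *)
Lemma P_boundary_ge_half N C : adapted N C -> (2^-1%:E * P C <= P (C `&` A))%E.
Proof.
move=> NC; have mC := measurable_adapted Gcount NC.
pose E : set (path_space G) := infinitely_often [set g | 2^-1 <= u g].
have PE : P E = 1%E by exact: u_recurrent.
have mE : measurable E by exact: measurable_infinitely_often.
(* [N + j] is the first time from [N] on at which [u] is at least 1/2. *)
pose D j : set (path_space G) := [set x | [/\ C x,
  (forall m, (N <= m)%N -> (m < N + j)%N -> u (x m) < 2^-1) & 2^-1 <= u (x (N + j)%N)]].
have nD j : adapted (N + j) (D j).
  move=> x x' xx' [Cx lt ge]; split.
  - by apply: NC Cx => m mN; apply: xx'; exact: leq_trans (leq_addr _ _).
  - by move=> m Nm mj; rewrite -xx' ?(ltnW mj)//; exact: lt.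
  - by rewrite -xx'.
have mD j := measurable_adapted Gcount (nD j).
have tD : trivIset setT D.
  apply/trivIsetP => j k _ _ jk; wlog lt_jk : j k jk / (j < k)%N.
    move=> W; case: (ltngtP j k) jk => // h _; first by apply: W => //; rewrite ltn_eqF.
    by rewrite setIC; apply: W => //; rewrite ltn_eqF.
  apply/seteqP; split => // x [[_ _ ge] [_ lt _]].
  have := lt _ (leq_addr j N); rewrite ltn_add2l => /(_ lt_jk).
  by rewrite ltNge ge.
have CE : C `&` E `<=` \bigcup_j D j.
  move=> x [Cx /(_ N)[n Nn un]].
  have ex : exists j, 2^-1 <= u (x (N + j)%N) by exists (n - N)%N; rewrite subnKC.
  have := ex_minnP ex => -[j uj jmin]; exists j => //; split=> // m Nm mj.
  rewrite ltNge; apply/negP => um.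
  have := jmin (m - N)%N; rewrite subnKC// => /(_ um).
  by rewrite leqNgt ltn_subLR ?mj.
have PCE : P C = P (C `&` E).
  have : P (C `\` E) = 0%E.
    apply/eqP; rewrite eq_le measure_ge0 andbT.
    have <- : P (~` E) = 0%E by rewrite probability_setC// PE subee.
    rewrite le_measure ?inE//; [exact: measurableD|exact: measurableC].
  move=> h; have : P C = (P (C `&` E) + P (C `\` E))%E.
    rewrite -measureU; [by rewrite setUIDK|exact: measurableI|exact: measurableD|].
    by apply/seteqP; split => // x [[_ ?] [_]].
  by rewrite h adde0.
rewrite PCE; apply: (@le_trans _ _ (2^-1%:E * P (\bigcup_j D j))%E).
  rewrite lee_wpmul2l// le_measure ?inE//; [exact: measurableI|exact: bigcupT_measurable].
apply: (@le_trans _ _ (P (\bigcup_j (D j `&` A)))); last first.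
  rewrite le_measure ?inE//.
  - by apply: bigcupT_measurable => j; exact: measurableI.
  - exact: measurableI.
  - by move=> x [j _ [[Cx _ _] Ax]].
rewrite !measure_semi_bigcup//.
- rewrite -nneseriesZl//; apply: lee_nneseries => [j _ _|j _]; first by rewrite mule_ge0.
  by apply: (@P_boundary_ge_half_adapted (N + j)) => // x [].
- by move=> j; exact: measurableI.
- exact: trivIset_setIr.
- by apply: bigcupT_measurable => j; exact: measurableI.
- exact: bigcupT_measurable.
Qed.

(** An event of finitely many steps that approximates the complement of [A] meets
    [A] in almost no mass, while [A] fills at least half of it: it is almost
    null. *)
Lemma recurrent_boundary_full : P A = 1%E.
Proof.
suff h : P (~` A) = 0%E.
  have := probability_setC P mA; rewrite h => e.
  have [a PA] : exists a, P A = a%:E by exists (fine (P A));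
    rewrite fineK// fin_num_measure.
  by move: e; rewrite PA => -[] /eqP; rewrite eq_sym subr_eq0 => /eqP <-.
have mAC := measurableC mA.
apply/eqP; rewrite eq_le measure_ge0 andbT; apply/lee_addgt0Pr => e e0; rewrite add0e.
have e30 : 0 < e / 3 by rewrite divr_gt0.
have [_ /(_ _ e30)[n [C [nC hC]]]] := measurable_approximable P Gcount mAC.
have mC := measurable_adapted Gcount nC.
have mY : measurable (~` A `+` C) by apply: measurableU; exact: measurableD.
have h1 : (P (C `&` A) <= (e / 3)%:E)%E.
  apply: le_trans hC; rewrite le_measure ?inE//; first exact: measurableI.
  by move=> x [Cx Ax]; right; split=> // nA; exact: nA.
have h2 := P_boundary_ge_half nC.
have h3 : (P (~` A) <= P C + (e / 3)%:E)%E.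
  apply: (@le_trans _ _ (P C + P (~` A `+` C))%E); last by rewrite leeD2l.
  apply: le_trans (measureU2 _ _ _) => //.
  rewrite le_measure ?inE//; first exact: measurableU.
  by move=> x nA; have [Cx|nC'] := pselect (C x); [left|right; left].
have [a Pa] : exists a, P (~` A) = a%:E by exists (fine (P (~` A)));
  rewrite fineK// fin_num_measure.
have [c Pc] : exists c, P C = c%:E by exists (fine (P C)); rewrite fineK// fin_num_measure.
have [d Pd] : exists d, P (C `&` A) = d%:E.
  by exists (fine (P (C `&` A))); rewrite fineK// fin_num_measure//; exact: measurableI.
move: h1 h2 h3; rewrite Pa Pc Pd -EFinM -EFinD !lee_fin; lra.
Qed.

End Recurrence.

(** * Harmonic functions invariant under the kernel, and the theorem *)

Section Main.
Context {R : realType} {H G K : groupType}.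
Variables (i : {multiplicative H -> G}) (p : {multiplicative G -> K}).
Hypothesis exact_HGK : short_exact i p.
Variables (mu : G -> R) (P : probability (path_space G) R) (Q : probability (path_space K) R).
Hypothesis mu_prob : is_prob mu.
Hypothesis P_law : walk_law mu P.
Hypothesis Q_law : walk_law (projection p mu) Q.
Hypothesis Gcount : countable [set: G].

Lemma countable_quotient : countable [set: K].
Proof.
have [_ _ pS] := exact_HGK.
have /choice[sec secE] : forall k, exists g, p g = k.
  by move=> k; have : range p k by [rewrite pS]; case=> g _ <-; exists g.
have /countable_inj[c cI] := Gcount; apply/countable_inj.
by exists (c \o sec) => k k' /= /cI e; rewrite -(secE k) -(secE k') e.
Qed.

Lemma fiber_invariant (u : G -> R) : (forall h g, u (i h * g)%g = u g) ->
  forall g g', p g = p g' -> u g = u g'.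
Proof.
move=> uH g g' gg'; have [_ iK _] := exact_HGK.
have : range i (g * g'^-1)%g.
  by rewrite iK /= gmulfM multiplicativeV gg' mulgV.
by case=> h _ hE; rewrite -(uH h g') hE mulgVK.
Qed.

(** The functions of boundary events factor through K, so the recurrence
    required by [recurrent_boundary_full] is a boundary event of K. If it has
    probability 1 for [A], then [A] is full; if not, it holds for the complement
    of [A], whose function is 1 - u. *)
Lemma liouville_extension : liouville Q ->
  (forall A, boundary_sets A -> forall h g, boundary_fun P A (i h * g)%g = boundary_fun P A g) ->
  liouville P.
Proof.
move=> Q01 uH A bA; have Kcount := countable_quotient.
set u := boundary_fun P A; have up := fiber_invariant (uH A bA).
pose B : set K := [set k | exists2 g, p g = k & 2^-1 < u g].
have mB := measurable_infinitely_often B.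
have bB : boundary_sets (infinitely_often B).
  split; first exact: mB.
  move=> x x' [a [b xx']] Bx N; have [n Nn Bn] := Bx (a + N)%N.
  have an : (a <= n)%N := leq_trans (leq_addr _ _) Nn.
  exists (b + (n - a))%N; last by rewrite -xx' subnKC.
  by apply: leq_trans (leq_addl _ _); rewrite leq_subRL.
have E : project p @^-1` (infinitely_often B) = infinitely_often [set g | 2^-1 < u g].
  apply/seteqP; split => x h N; have [n Nn] := h N; rewrite /B /project /=.
    by move=> [g /up gu ug]; exists n => //=; rewrite /u -gu.
  by move=> un; exists n => //; exists (x n).
have QE : Q (infinitely_often B) = P (infinitely_often [set g | 2^-1 < u g]).
  by rewrite (project_law mu_prob P_law Q_law Kcount mB) E.
have mU := @measurable_infinitely_often G [set g | 2^-1 < u g].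
have mUw v : measurable (@infinitely_often G [set g | 2^-1 <= v g]).
  exact: measurable_infinitely_often.
have [Q0|Q1] := Q01 _ bB; [left|right].
- have bAC := boundary_setC bA.
  have PC : P (~` A) = 1%E.
    apply: (recurrent_boundary_full P_law Gcount bAC).
    apply/eqP; rewrite eq_le probability_le1//=.
    have <- : P (~` infinitely_often [set g | 2^-1 < u g]) = 1%E.
      by rewrite probability_setC// -QE Q0 sube0.
    rewrite le_measure ?inE//; first exact: measurableC.
    move=> x nx N; apply: contrapT => h; apply: nx => M.
    have [NM|NM] := leqP N M; last first.
      exists N; first exact: ltnW.
      rewrite /= ltNge; apply/negP => le; apply: h; exists N => //=.
      by rewrite boundary_funC//; rewrite /u in le; lra.
    exists M => //=; rewrite ltNge; apply/negP => le; apply: h; exists M => //=.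
    by rewrite boundary_funC//; rewrite /u in le; lra.
  have := probability_setC P bA.1; rewrite PC.
  have [a ->] : exists a, P A = a%:E by exists (fine (P A));
    rewrite fineK// fin_num_measure//; exact: bA.1.
  by move=> [] /eqP; rewrite eq_sym subr_eq addrC -subr_eq subrr => /eqP <-.
- apply: (recurrent_boundary_full P_law Gcount bA).
  apply/eqP; rewrite eq_le probability_le1//=.
  rewrite -Q1 QE le_measure ?inE// => x h N; have [n Nn /ltW un] := h N.
  by exists n.
Qed.

Variables (S : set K) (f : nat -> R).

Lemma small_span_sub (T T' : set H) :
  T `<=` T' -> small_span i p S f T' -> small_span i p S f T.
Proof.
move=> TT' sT eps e0; have [delta [C [d0 C0 h]]] := sT _ e0.
exists delta, C; split=> // n; apply: le_trans (h n).
apply: subset_counting => t [s [sn sS tE]]; exists s; split=> // x /sS.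
by move=> [k [t0 [kr /TT' Tt0 kt]]]; exists k, t0.
Qed.

End Main.

Theorem theorem8p9 (R : realType) (f : nat -> R)
    (f_incr : {homo f : m n / (m <= n)%N >-> m <= n})
    (f_pos : exists n, 0 < f n)
    (H G K : groupType)
    (i : {multiplicative H -> G}) (p : {multiplicative G -> K})
    (exact_HGK : short_exact i p)
    (abelian_H : forall x y : H, (x * y = y * x)%g)
    (mu : G -> R) (mu_prob : is_prob mu)
    (mu_nondeg : non_degenerate mu) (mu_entropy : (entropy mu < +oo)%E)
    (P : probability (path_space G) R) (P_law : walk_law mu P)
    (Q : probability (path_space K) R) (Q_law : walk_law (projection p mu) Q)
    (S : set K) (S_fin : finite_set S) (S_gen : generates S)
    (Q_cautious : cautious S f Q) (Q_liouville : liouville Q) :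
  (forall T : set H, finite_set T ->
     small_span i p S f T -> generates T -> liouville P) /\
  (forall h : H, small_span i p S f [set h] -> acts_trivially P (i h)).
Proof.
have Gcount := countable_group mu_prob P_law mu_nondeg.
have Kcount := countable_quotient exact_HGK Gcount.
have cautious_walk := cautious_stays_good mu_prob P_law Q_law Kcount f_incr f_pos Q_cautious.
have invariant h : small_span i p S f [set h] -> forall A, boundary_sets A ->
    forall g, boundary_fun P A (i h * g)%g = boundary_fun P A g.
  move=> h_span A bA; apply: (harmonic_span_invariant exact_HGK mu_prob mu_nondeg P_law cautious_walk _ _ h_span).
    exact: boundary_fun_itv.
  by move=> x; exact: (boundary_fun_harmonic P_law mu_prob Gcount).
split; last first.
  move=> h h_span A bA; apply: (invariant_boundary_fun_acts_trivially P_law Gcount bA).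
  exact: invariant.
move=> T _ T_span T_gen;
  apply: (liouville_extension exact_HGK mu_prob P_law Q_law Gcount Q_liouville).
move=> A bA.
pose E : set H := [set h | forall g, boundary_fun P A (i h * g)%g = boundary_fun P A g].
have ET : E = [set: H].
  apply: T_gen; last first.
    move=> t Tt; apply: invariant => //.
    by apply: small_span_sub T_span => _ ->.
  split.
  - by move=> g; rewrite multiplicative1 mul1g.
  - by move=> x y Ex Ey g; rewrite gmulfM -mulgA Ex Ey.
  - by move=> x Ex g; rewrite multiplicativeV -[LHS]Ex mulVKg.
by move=> h; have : E h by rewrite ET.
Qed.
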